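(* Let $F:\mathcal A/\Gamma\to S^3$ be a flat torus immersed in $S^3$ and consider its Gauss map $$G:\mathcal A/\Gamma\to S^2_{\mathcal A}\simeq S^2\times S^2 .$$ Its image is a product of closed curves $\gamma_1\times\gamma_2$ whose geodesic curvatures $k_{\gamma_1}$ and $k_{\gamma_2}$ satisfy $$-\pi<\int_{\mathcal I}k_{\gamma_1}-\int_{\mathcal J}k_{\gamma_2}<\pi$$ for all (bounded) subintervals $\mathcal I,\mathcal J$ of $\mathbb R$, and $$\int_{\gamma_1}k_{\gamma_1}=\int_{\gamma_2}k_{\gamma_2}=0 .$$
   Context: $\mathcal A=\{x+\sigma y:\ x,y\in\mathbb R\}$ is the algebra of Lorentz numbers, $\sigma^2=1$. The Gauss map of an oriented surface in $\mathbb R^4$ takes values in $\mathcal Q=\{\eta\in\Lambda^2\mathbb R^4:\ |\eta|=1,\ \eta\wedge\eta=0\}$ and is $p\mapsto u_1\wedge u_2$, $(u_1,u_2)$ a positively oriented orthonormal basis of the tangent plane. $\Lambda^2\mathbb R^4$ is an $\mathcal A$-module, $\sigma$ acting as the Hodge star, with $\mathcal A$-basis $I=e_2^o\wedge e_3^o$, $J=e_3^o\wedge e_1^o$, $K=e_1^o\wedge e_2^o$, where $(e_0^o,e_1^o,e_2^o,e_3^o)$ is the canonical basis of $\mathbb R^4$; then $\mathcal Q=S^2_{\mathcal A}:=\{aI+bJ+cK:\ a,b,c\in\mathcal A,\ a^2+b^2+c^2=1\}$, and $S^2_{\mathcal A}\simeq S^2\times S^2$ by $\xi=\frac{1+\sigma}2\xi_++\frac{1-\sigma}2\xi_-\mapsto(\xi_+,\xi_-)$,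 where $S^2$ is the unit sphere of the imaginary quaternions $\mathbb RI\oplus\mathbb RJ\oplus\mathbb RK$. A flat torus immersed in $S^3$ can always be written with domain $\mathcal A/\Gamma$, where $\Gamma$ is a rank-two lattice of translations of $\mathcal A\simeq\mathbb R^2$, and where $\mathcal A/\Gamma$ carries the Lorentz structure induced by the Gauss map (so that $dG(\sigma u)=\sigma\,dG(u)$). The closed curves $\gamma_1,\gamma_2$ are regarded as periodic arc length parametrized curves $\mathbb R\to S^2$; the integrals are with respect to arc length, $\int_{\gamma_i}$ denoting the integral over one period; both geodesic curvatures are taken with respect to the same orientation of $S^2$. *)

(* Defs.v *)
From Stdlib Require Import Reals Lra ZArith.
From Coquelicot Require Import Coquelicot.
Open Scope R_scope.

(** * Lorentz numbers *)

(* The pair (x, y) stands for x + sigma y with sigma^2 = 1. *)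
Definition lorentz : Type := (R * R)%type.

Definition Lsigma : lorentz := (0, 1).
Definition Lreal (x : R) : lorentz := (x, 0).
Definition Lplus (a b : lorentz) : lorentz := (fst a + fst b, snd a + snd b).
Definition Lmult (a b : lorentz) : lorentz :=
  (fst a * fst b + snd a * snd b, fst a * snd b + snd a * fst b).
Definition Lscal (r : R) (a : lorentz) : lorentz := (r * fst a, r * snd a).
Definition Ldet (a b : lorentz) : R := fst a * snd b - snd a * fst b.

Definition rank_two_lattice (Gam : lorentz -> Prop) : Prop :=
  exists g1 g2 : lorentz, Ldet g1 g2 <> 0 /\
    forall z, Gam z <->
      exists m n : Z, z = Lplus (Lscal (IZR m) g1) (Lscal (IZR n) g2).

(** * R^4 and its bivectors *)

Record vec4 := Vec4 { c0 : R; c1 : R; c2 : R; c3 : R }.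

Definition zero4 : vec4 := Vec4 0 0 0 0.
Definition dot4 (u v : vec4) : R :=
  c0 u * c0 v + c1 u * c1 v + c2 u * c2 v + c3 u * c3 v.

Definition e0 : vec4 := Vec4 1 0 0 0.
Definition e1 : vec4 := Vec4 0 1 0 0.
Definition e2 : vec4 := Vec4 0 0 1 0.
Definition e3 : vec4 := Vec4 0 0 0 1.

(* bij is the coefficient of e_i /\ e_j; these six bivectors form an
   orthonormal basis of the second exterior power of R^4. *)
Record bivec := Bivec { b01 : R; b02 : R; b03 : R; b23 : R; b31 : R; b12 : R }.

Definition wedge (u v : vec4) : bivec :=
  Bivec (c0 u * c1 v - c1 u * c0 v) (c0 u * c2 v - c2 u * c0 v)
        (c0 u * c3 v - c3 u * c0 v) (c2 u * c3 v - c3 u * c2 v)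
        (c3 u * c1 v - c1 u * c3 v) (c1 u * c2 v - c2 u * c1 v).

Definition bplus (p q : bivec) : bivec :=
  Bivec (b01 p + b01 q) (b02 p + b02 q) (b03 p + b03 q)
        (b23 p + b23 q) (b31 p + b31 q) (b12 p + b12 q).
Definition bscal (r : R) (p : bivec) : bivec :=
  Bivec (r * b01 p) (r * b02 p) (r * b03 p) (r * b23 p) (r * b31 p) (r * b12 p).

Definition bnorm2 (p : bivec) : R :=
  b01 p ^ 2 + b02 p ^ 2 + b03 p ^ 2 + b23 p ^ 2 + b31 p ^ 2 + b12 p ^ 2.

(* p /\ p = wedge_sq p * (e0 /\ e1 /\ e2 /\ e3). *)
Definition wedge_sq (p : bivec) : R :=
  2 * (b01 p * b23 p + b02 p * b31 p + b03 p * b12 p).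

(* Hodge star for the orientation e0 /\ e1 /\ e2 /\ e3. *)
Definition hodge (p : bivec) : bivec :=
  Bivec (b23 p) (b31 p) (b12 p) (b01 p) (b02 p) (b03 p).

(* Module structure over the Lorentz numbers, sigma acting as the Hodge star. *)
Definition lact (a : lorentz) (p : bivec) : bivec :=
  bplus (bscal (fst a) p) (bscal (snd a) (hodge p)).

Definition bI : bivec := wedge e2 e3.
Definition bJ : bivec := wedge e3 e1.
Definition bK : bivec := wedge e1 e2.

Definition lcomb (a b c : lorentz) : bivec :=
  bplus (bplus (lact a bI) (lact b bJ)) (lact c bK).

(* Unit decomposable bivectors: the Grassmannian of oriented planes. *)
Definition in_Q (p : bivec) : Prop := sqrt (bnorm2 p) = 1 /\ wedge_sq p = 0.

(** * Imaginary quaternions and the identification of Q with S^2 x S^2 *)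

Record imq := Imq { qi : R; qj : R; qk : R }.

Definition dot3 (u v : imq) : R := qi u * qi v + qj u * qj v + qk u * qk v.
Definition cross3 (u v : imq) : imq :=
  Imq (qj u * qk v - qk u * qj v) (qk u * qi v - qi u * qk v)
      (qi u * qj v - qj u * qi v).
Definition in_S2 (u : imq) : Prop := dot3 u u = 1.

Definition imq_bivec (u : imq) : bivec :=
  lcomb (Lreal (qi u)) (Lreal (qj u)) (Lreal (qk u)).

(* (1 + sigma)/2 xp + (1 - sigma)/2 xm, the inverse of xi |-> (xi_+, xi_-). *)
Definition of_pair (xp xm : imq) : bivec :=
  bplus (lact (/ 2, / 2) (imq_bivec xp)) (lact (/ 2, - / 2) (imq_bivec xm)).

Lemma in_Q_sq (p : bivec) : in_Q p <-> bnorm2 p = 1 /\ wedge_sq p = 0.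
Proof.
  assert (H : 0 <= bnorm2 p)
    by (unfold bnorm2; repeat apply Rplus_le_le_0_compat; apply pow2_ge_0).
  unfold in_Q; split; intros [Hn Hw]; split; auto.
  - rewrite <- (sqrt_sqrt _ H), Hn; ring.
  - rewrite Hn; apply sqrt_1.
Qed.

Lemma in_Q_lcomb (a b c : lorentz) :
  in_Q (lcomb a b c) <->
  Lplus (Lplus (Lmult a a) (Lmult b b)) (Lmult c c) = Lreal 1.
Proof.
  rewrite in_Q_sq. destruct a as [a a'], b as [b b'], c as [c c'].
  unfold bnorm2, wedge_sq, Lplus, Lmult, Lreal; simpl.
  split.
  - intros [Hn Hw]; f_equal; lra.
  - intros H; injection H as H1 H2; split; lra.
Qed.

Lemma of_pair_bij (p : bivec) :
  exists! x : imq * imq, p = of_pair (fst x) (snd x).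
Proof.
  exists (Imq (b23 p + b01 p) (b31 p + b02 p) (b12 p + b03 p),
          Imq (b23 p - b01 p) (b31 p - b02 p) (b12 p - b03 p)).
  split.
  - destruct p; unfold of_pair, bplus; simpl; f_equal; field.
  - intros [[xi xj xk] [yi yj yk]] ->; unfold of_pair, bplus; simpl.
    f_equal; f_equal; field.
Qed.

Lemma in_Q_of_pair (xp xm : imq) :
  in_Q (of_pair xp xm) <-> in_S2 xp /\ in_S2 xm.
Proof.
  rewrite in_Q_sq. destruct xp as [xi xj xk], xm as [yi yj yk].
  unfold in_S2, bnorm2, wedge_sq, dot3; simpl.
  split; intros [H1 H2]; split; lra.
Qed.

(** * Calculus for maps defined on the Lorentz numbers *)

Definition smooth (f : lorentz -> R) : Prop :=
  forall (n : nat) (x y : R), ex_diff_n (fun a b => f (a, b)) n x y.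

Definition diff (f : lorentz -> R) (p u : lorentz) : R :=
  Derive (fun h => f (Lplus p (Lscal h u))) 0.

Definition smooth4 (F : lorentz -> vec4) : Prop :=
  smooth (fun p => c0 (F p)) /\ smooth (fun p => c1 (F p)) /\
  smooth (fun p => c2 (F p)) /\ smooth (fun p => c3 (F p)).

Definition diff4 (F : lorentz -> vec4) (p u : lorentz) : vec4 :=
  Vec4 (diff (fun q => c0 (F q)) p u) (diff (fun q => c1 (F q)) p u)
       (diff (fun q => c2 (F q)) p u) (diff (fun q => c3 (F q)) p u).

Definition diffb (G : lorentz -> bivec) (p u : lorentz) : bivec :=
  Bivec (diff (fun q => b01 (G q)) p u) (diff (fun q => b02 (G q)) p u)
        (diff (fun q => b03 (G q)) p u) (diff (fun q => b23 (G q)) p u)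
        (diff (fun q => b31 (G q)) p u) (diff (fun q => b12 (G q)) p u).

Definition immersion (F : lorentz -> vec4) : Prop :=
  smooth4 F /\ forall p u, diff4 F p u = zero4 -> u = (0, 0).

(** * Flatness of the induced metric *)

(* Tensor indices are booleans: false is the coordinate x, true is y. *)
Definition basis (i : bool) : lorentz := if i then (0, 1) else (1, 0).
Definition sum2 (f : bool -> R) : R := f false + f true.
Definition partial (i : bool) (f : lorentz -> R) (p : lorentz) : R :=
  diff f p (basis i).

Definition metric (F : lorentz -> vec4) (i j : bool) (p : lorentz) : R :=
  dot4 (diff4 F p (basis i)) (diff4 F p (basis j)).

Definition inv_metric (g : bool -> bool -> lorentz -> R) (i j : bool)
    (p : lorentz) : R :=
  (if Bool.eqb i j then g (negb i) (negb i) p else - g i j p)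
  / (g false false p * g true true p - g false true p * g true false p).

(* Gamma^k_ij *)
Definition christoffel (g : bool -> bool -> lorentz -> R) (k i j : bool)
    (p : lorentz) : R :=
  sum2 (fun l => / 2 * inv_metric g k l p *
    (partial i (g j l) p + partial j (g i l) p - partial l (g i j) p)).

(* R^l_kij, where R(d_i, d_j) d_k = R^l_kij d_l *)
Definition riemann (g : bool -> bool -> lorentz -> R) (l k i j : bool)
    (p : lorentz) : R :=
  partial i (christoffel g l j k) p - partial j (christoffel g l i k) p
  + sum2 (fun m => christoffel g l i m p * christoffel g m j k p
                   - christoffel g l j m p * christoffel g m i k p).

Definition flat (F : lorentz -> vec4) : Prop :=
  forall l k i j p, riemann (metric F) l k i j p = 0.

(** * Gauss map *)

(* The orientation is eps dx /\ dy, with eps = 1 or eps = -1. *)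
Definition pos_orthonormal_basis (F : lorentz -> vec4) (eps : R) (p : lorentz)
    (u1 u2 : vec4) : Prop :=
  (exists a b : lorentz,
     u1 = diff4 F p a /\ u2 = diff4 F p b /\ 0 < eps * Ldet a b) /\
  dot4 u1 u1 = 1 /\ dot4 u2 u2 = 1 /\ dot4 u1 u2 = 0.

Definition is_gauss_map (F : lorentz -> vec4) (eps : R) (G : lorentz -> bivec)
    : Prop :=
  forall p u1 u2, pos_orthonormal_basis F eps p u1 u2 -> G p = wedge u1 u2.

(** * Closed curves in the sphere *)

Definition smooth1 (f : R -> R) : Prop := forall n s, ex_derive_n f n s.

Definition deriv3 (n : nat) (c : R -> imq) (s : R) : imq :=
  Imq (Derive_n (fun r => qi (c r)) n s) (Derive_n (fun r => qj (c r)) n s)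
      (Derive_n (fun r => qk (c r)) n s).

Definition is_period (c : R -> imq) (L : R) : Prop :=
  0 < L /\ forall s, c (s + L) = c s.

(* Smooth periodic curve in S^2 parametrized by arc length. *)
Definition closed_curve (c : R -> imq) : Prop :=
  (smooth1 (fun s => qi (c s)) /\ smooth1 (fun s => qj (c s)) /\
   smooth1 (fun s => qk (c s))) /\
  (forall s, in_S2 (c s)) /\
  (forall s, dot3 (deriv3 1 c s) (deriv3 1 c s) = 1) /\
  exists L, is_period c L.

(* For an arc length parametrization; S^2 is oriented by its outer normal. *)
Definition geod_curv (c : R -> imq) (s : R) : R :=
  dot3 (deriv3 2 c s) (cross3 (c s) (deriv3 1 c s)).

Definition change_of_parameter (phi : R -> R) : Prop :=
  (forall s, ex_derive phi s /\ 0 < Derive phi s) /\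
  forall r, exists s, phi s = r.

(* Main.v *)
(* In the null coordinates s = x + y, t = x - y the hypothesis on dG says that
   the two components of G are curves alpha(s) and beta(t).  Write R^4 as the
   quaternions: if N is the unit normal of the torus in S^3, then
   N = alpha F = F beta up to sign, hence on tangent vectors left multiplication
   by alpha is minus right multiplication by beta, and differentiating
   alpha F = F beta gives F_s = (1/2) alpha alpha' F and F_t = (1/2) F beta' beta.
   So alpha and beta are regular; they are periodic because the lattice has a
   nonzero projection on each null axis, and can be parametrized by arc length.
   Conjugation by F carries alpha to beta and alpha' to a vector of the tangent
   plane of S^2 at beta; let omega be its angle with beta'.  The formulas for F_s
   and F_t yield d omega = k_1 ds - k_2 dt, and sin omega never vanishes since F is
   an immersion.  Hence omega stays in (0, pi) or in (-pi, 0), which is the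
   announced bound, and applying the bound to n periods for all n shows that the
   total curvatures vanish. *)
Require Import Defs.
From Stdlib Require Import Reals Lra Lia ZArith Ranalysis5 ClassicalEpsilon.
From Coquelicot Require Import Coquelicot.
(* The standard library also has a projection named c0. *)
Import Defs.
Open Scope R_scope.

Lemma eq_derive (f : R -> R) (x l l' : R) :
  is_derive f x l -> l = l' -> is_derive f x l'.
Proof. intros H <-; exact H. Qed.

(** * Smooth functions of one variable *)

(** Strips the innermost derivative first, whereas [ex_derive_n] adds the outermost one; this order
    lets the product, chain and quotient rules drive an induction on [n] over all functions. *)
Fixpoint differentiable_n (n : nat) (f : R -> R) : Prop :=
  match n with
  | O => True
  | S m => (forall x, ex_derive f x) /\ differentiable_n m (Derive f)
  end.

Lemma differentiable_n_ext (n : nat) (f g : R -> R) :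
  (forall x, f x = g x) -> differentiable_n n f -> differentiable_n n g.
Proof.
  revert f g; induction n as [|n IH]; intros f g E; simpl; auto.
  intros [H1 H2]; split.
  - intros x; apply (ex_derive_ext f); auto.
  - apply (IH (Derive f)); auto. intros x; apply Derive_ext, E.
Qed.

Lemma differentiable_n_pred (n : nat) (f : R -> R) :
  differentiable_n (S n) f -> differentiable_n n f.
Proof.
  revert f; induction n as [|n IH]; intros f H; simpl; auto.
  destruct H as [H1 H2]; split; auto.
Qed.

Lemma smooth1_iff (f : R -> R) :
  smooth1 f <-> forall n, differentiable_n n f.
Proof.
  split.
  - intros H n; revert f H; induction n as [|n IH]; intros f H; simpl; auto.
    split; [exact (H 1%nat)|]. apply IH. intros [|m] x; [exact I|].
    simpl. apply (ex_derive_ext (Derive_n f (S m))).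
    + intros t; change (Derive f) with (Derive_n f 1).
      rewrite Derive_n_comp; f_equal; lia.
    + apply (H (S (S m))).
  - intros H n; specialize (H n); revert f H.
    induction n as [|n IH]; intros f H x; [exact I|].
    destruct H as [H1 H2]; specialize (IH _ H2 x).
    destruct n as [|m]; [apply H1|].
    simpl in IH |- *. apply (ex_derive_ext (Derive_n (Derive f) m)); auto.
    intros t; change (Derive f) with (Derive_n f 1).
    rewrite Derive_n_comp.
    replace (m + 1)%nat with (S m) by lia; reflexivity.
Qed.

Lemma smooth1_ex_derive (f : R -> R) (x : R) : smooth1 f -> ex_derive f x.
Proof. intros H; exact (H 1%nat x). Qed.

Lemma smooth1_Derive (f : R -> R) : smooth1 f -> smooth1 (Derive f).
Proof.
  rewrite !smooth1_iff; intros H n; exact (proj2 (H (S n))).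
Qed.

Lemma smooth1_ext (f g : R -> R) :
  (forall x, f x = g x) -> smooth1 f -> smooth1 g.
Proof.
  rewrite !smooth1_iff; intros E H n; exact (differentiable_n_ext n f g E (H n)).
Qed.

Lemma differentiable_n_const (n : nat) (c : R) : differentiable_n n (fun _ => c).
Proof.
  revert c; induction n as [|n IH]; intros c; simpl; auto; split.
  - intros x; apply ex_derive_const.
  - apply (differentiable_n_ext n (fun _ => 0)); auto.
    intros x; symmetry; apply Derive_const.
Qed.

Lemma differentiable_n_plus (n : nat) (f g : R -> R) :
  differentiable_n n f -> differentiable_n n g -> differentiable_n n (fun x => f x + g x).
Proof.
  revert f g; induction n as [|n IH]; intros f g; simpl; auto.
  intros [F1 F2] [G1 G2]; split.
  - intros x; apply (ex_derive_plus f g); auto.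
  - apply (differentiable_n_ext n (fun x => Derive f x + Derive g x)); auto.
    intros x; symmetry; apply Derive_plus; auto.
Qed.

Lemma differentiable_n_mult (n : nat) (f g : R -> R) :
  differentiable_n n f -> differentiable_n n g -> differentiable_n n (fun x => f x * g x).
Proof.
  revert f g; induction n as [|n IH]; intros f g HF HG; simpl; auto.
  (* In the product rule each factor also occurs undifferentiated, and is needed there only to order
     [n]. *)
  pose proof (differentiable_n_pred _ _ HF); pose proof (differentiable_n_pred _ _ HG).
  destruct HF as [F1 F2], HG as [G1 G2]; split.
  - intros x; apply (ex_derive_mult f g); auto.
  - apply (differentiable_n_ext n (fun x => Derive f x * g x + f x * Derive g x)).
    + intros x; symmetry; apply Derive_mult; auto.
    + apply (differentiable_n_plus n); apply IH; auto.
Qed.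

Lemma differentiable_n_comp (n : nat) (f g : R -> R) :
  differentiable_n n f -> differentiable_n n g -> differentiable_n n (fun x => f (g x)).
Proof.
  revert f g; induction n as [|n IH]; intros f g HF HG; simpl; auto.
  pose proof (differentiable_n_pred _ _ HG).
  destruct HF as [F1 F2], HG as [G1 G2]; split.
  - intros x; apply (ex_derive_comp f g); auto.
  - apply (differentiable_n_ext n (fun x => Derive g x * Derive f (g x))).
    + intros x; symmetry; apply Derive_comp; auto.
    + apply differentiable_n_mult; auto.
Qed.

Lemma differentiable_n_inv (n : nat) (f : R -> R) :
  (forall x, f x <> 0) -> differentiable_n n f -> differentiable_n n (fun x => / f x).
Proof.
  revert f; induction n as [|n IH]; intros f N HF; simpl; auto.
  pose proof (differentiable_n_pred _ _ HF).
  destruct HF as [F1 F2]; split.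
  - intros x; apply (ex_derive_inv f); auto.
  - apply (differentiable_n_ext n (fun x => (-1 * Derive f x) * (/ f x * / f x))).
    + intros x; rewrite Derive_inv; auto; field; auto.
    + repeat apply differentiable_n_mult; auto using differentiable_n_const.
Qed.

(** The derivative f' / (2 sqrt f) contains sqrt f again, but to one order less, so the induction
    closes through [differentiable_n_inv]. *)
Lemma differentiable_n_sqrt (n : nat) (f : R -> R) :
  (forall x, 0 < f x) -> differentiable_n n f -> differentiable_n n (fun x => sqrt (f x)).
Proof.
  revert f; induction n as [|n IH]; intros f N HF; simpl; auto.
  pose proof (differentiable_n_pred _ _ HF).
  destruct HF as [F1 F2].
  assert (D : forall x, is_derive (fun x => sqrt (f x)) x
                          (Derive f x / (2 * sqrt (f x)))).
  { intros x; apply is_derive_sqrt; auto; apply Derive_correct, F1. }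
  split.
  - intros x; eexists; apply D.
  - apply (differentiable_n_ext n (fun x => (/ 2 * Derive f x) * / sqrt (f x))).
    + intros x; symmetry; etransitivity; [apply is_derive_unique, D|]; field.
      apply Rgt_not_eq, sqrt_lt_R0, N.
    + repeat apply differentiable_n_mult; auto using differentiable_n_const.
      apply differentiable_n_inv; auto.
      intros x; apply Rgt_not_eq, sqrt_lt_R0, N.
Qed.

Lemma smooth1_const (c : R) : smooth1 (fun _ => c).
Proof. apply smooth1_iff; intros n; apply differentiable_n_const. Qed.

Lemma smooth1_plus (f g : R -> R) :
  smooth1 f -> smooth1 g -> smooth1 (fun x => f x + g x).
Proof. rewrite !smooth1_iff; intros; apply differentiable_n_plus; auto. Qed.

Lemma smooth1_mult (f g : R -> R) :
  smooth1 f -> smooth1 g -> smooth1 (fun x => f x * g x).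
Proof. rewrite !smooth1_iff; intros; apply differentiable_n_mult; auto. Qed.

Lemma smooth1_opp (f : R -> R) : smooth1 f -> smooth1 (fun x => - f x).
Proof.
  intros H; apply (smooth1_ext (fun x => -1 * f x)); [intros; ring|].
  apply smooth1_mult; auto using smooth1_const.
Qed.

Lemma smooth1_minus (f g : R -> R) :
  smooth1 f -> smooth1 g -> smooth1 (fun x => f x - g x).
Proof. intros; apply smooth1_plus; auto using smooth1_opp. Qed.

Lemma smooth1_comp (f g : R -> R) :
  smooth1 f -> smooth1 g -> smooth1 (fun x => f (g x)).
Proof. rewrite !smooth1_iff; intros; apply differentiable_n_comp; auto. Qed.

Lemma smooth1_inv (f : R -> R) :
  (forall x, f x <> 0) -> smooth1 f -> smooth1 (fun x => / f x).
Proof. rewrite !smooth1_iff; intros; apply differentiable_n_inv; auto. Qed.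

Lemma smooth1_sqrt (f : R -> R) :
  (forall x, 0 < f x) -> smooth1 f -> smooth1 (fun x => sqrt (f x)).
Proof. rewrite !smooth1_iff; intros; apply differentiable_n_sqrt; auto. Qed.

Lemma smooth1_continuous (f : R -> R) (x : R) : smooth1 f -> continuous f x.
Proof.
  intros H; apply (ex_derive_continuous (V := R_NormedModule)), smooth1_ex_derive, H.
Qed.

Create HintDb smooth.
#[export] Hint Resolve smooth1_const smooth1_plus smooth1_mult smooth1_minus
  smooth1_opp smooth1_Derive : smooth.

(** * Increasing diffeomorphisms of the line *)

Section Diffeomorphism.

Variables phi dphi : R -> R.
Hypothesis phi_derive : forall s, is_derive phi s (dphi s).
Hypothesis dphi_pos : forall s, 0 < dphi s.

Lemma positive_derive_lt (x y : R) : x < y -> phi x < phi y.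
Proof.
  intros H; apply (incr_function phi m_infty p_infty dphi); simpl; auto.
  intros; apply dphi_pos.
Qed.

Lemma positive_derive_inj (x y : R) : phi x = phi y -> x = y.
Proof.
  intros E; destruct (Rtotal_order x y) as [H|[H|H]]; auto;
    apply positive_derive_lt in H; lra.
Qed.

Variable psi : R -> R.
Hypothesis phi_psi : forall r, phi (psi r) = r.

Lemma inverse_lt (x y : R) : x < y -> psi x < psi y.
Proof.
  intros H; destruct (Rtotal_order (psi x) (psi y)) as [K|[K|K]]; auto.
  - apply (f_equal phi) in K; rewrite !phi_psi in K; lra.
  - apply positive_derive_lt in K; rewrite !phi_psi in K; lra.
Qed.

(** [phi] strictly increases, so its values at [psi r - e] and [psi r + e] enclose [r]; between
    those values the increasing [psi] stays within [e] of [psi r]. *)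
Lemma inverse_continuity (r : R) : continuity_pt psi r.
Proof.
  assert (psi_phi : forall s, psi (phi s) = s)
    by (intros s; apply positive_derive_inj; rewrite phi_psi; auto).
  apply continuity_pt_filterlim. intros P [e He].
  assert (H1 : phi (psi r - e) < r).
  { rewrite <- (phi_psi r) at 2; apply positive_derive_lt.
    pose proof (cond_pos e); lra. }
  assert (H2 : r < phi (psi r + e)).
  { rewrite <- (phi_psi r) at 1; apply positive_derive_lt.
    pose proof (cond_pos e); lra. }
  assert (Hd : 0 < Rmin (r - phi (psi r - e)) (phi (psi r + e) - r))
    by (apply Rmin_case; lra).
  exists (mkposreal _ Hd); intros y Hy; apply He.
  unfold ball in *; simpl in *; unfold AbsRing_ball, abs, minus, plus, opp in *.
  simpl in *. pose proof (Rmin_l (r - phi (psi r - e)) (phi (psi r + e) - r)).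
  pose proof (Rmin_r (r - phi (psi r - e)) (phi (psi r + e) - r)).
  apply Rabs_def2 in Hy.
  assert (K1 : psi (phi (psi r - e)) < psi y) by (apply inverse_lt; lra).
  assert (K2 : psi y < psi (phi (psi r + e))) by (apply inverse_lt; lra).
  rewrite psi_phi in K1, K2. apply Rabs_def1; lra.
Qed.

Lemma inverse_derive (r : R) : is_derive psi r (/ dphi (psi r)).
Proof.
  assert (Prf : forall a, psi (r - 1) <= a <= psi (r + 1) -> derivable_pt phi a).
  { intros a _; exists (dphi a); apply is_derive_Reals, phi_derive. }
  assert (Inc : psi (r - 1) <= psi r <= psi (r + 1))
    by (split; left; apply inverse_lt; lra).
  assert (E : derive_pt phi (psi r) (Prf (psi r) Inc) = dphi (psi r)).
  { apply derive_pt_eq_0, is_derive_Reals, phi_derive. }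
  apply is_derive_Reals. rewrite <- E.
  replace (/ derive_pt phi (psi r) (Prf (psi r) Inc))
    with (1 / derive_pt phi (psi r) (Prf (psi r) Inc)) by (unfold Rdiv; ring).
  apply derivable_pt_lim_recip_interv with (lb := r - 1) (ub := r + 1); try lra.
  - apply inverse_continuity.
  - intros x _; apply phi_psi.
  - rewrite E; apply Rgt_not_eq, dphi_pos.
Qed.

(** Bootstrap: psi' is the inverse of [dphi (psi r)], which is as differentiable as [psi] itself, so
    each order yields the next. *)
Lemma inverse_smooth : smooth1 dphi -> smooth1 psi.
Proof.
  rewrite !smooth1_iff; intros H n.
  induction n as [|n IH]; simpl; auto; split.
  - intros r; eexists; apply inverse_derive.
  - apply (differentiable_n_ext n (fun r => / dphi (psi r))).
    + intros r; symmetry; apply is_derive_unique, inverse_derive.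
    + apply (differentiable_n_inv n (fun r => dphi (psi r))).
      * intros r; apply Rgt_not_eq, dphi_pos.
      * apply differentiable_n_comp; auto.
Qed.

End Diffeomorphism.

(** * Primitives of periodic functions *)

Lemma zero_derive_const (f : R -> R) :
  (forall x, is_derive f x 0) -> forall x y, f x = f y.
Proof.
  intros H x y; destruct (Rtotal_order x y) as [L|[->|L]]; auto.
  - apply (eq_is_derive f x y); auto.
  - symmetry; apply (eq_is_derive f y x); auto.
Qed.

Lemma RInt_0_derive (v : R -> R) (s : R) :
  smooth1 v -> is_derive (fun x => RInt v 0 x) s (v s).
Proof.
  intros Sv; apply (is_derive_RInt v (fun x => RInt v 0 x) 0).
  - exists (mkposreal _ Rlt_0_1); intros y _.
    apply (RInt_correct (V := R_CompleteNormedModule) v 0 y).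
    apply (ex_RInt_continuous (V := R_CompleteNormedModule) v).
    intros; apply smooth1_continuous, Sv.
  - apply smooth1_continuous, Sv.
Qed.

(** The increment of the primitive over a shift by [P] has derivative v (s + P) - v s = 0, hence
    equals its value at 0. *)
Lemma RInt_0_periodic (v : R -> R) (P s : R) :
  smooth1 v -> (forall r, v (r + P) = v r) ->
  RInt v 0 (s + P) = RInt v 0 s + RInt v 0 P.
Proof.
  intros Sv vP. set (phi := (fun s => RInt v 0 s) : R -> R).
  assert (phi0 : phi 0 = 0) by apply (RInt_point 0 v).
  assert (K : phi (s + P) - phi s = phi (0 + P) - phi 0).
  { apply (zero_derive_const (fun s => phi (s + P) - phi s)); intros x.
    eapply eq_derive.
    - apply (is_derive_minus (fun s => phi (s + P)) phi);
        [|apply RInt_0_derive, Sv].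
      apply (is_derive_comp phi (fun s => s + P)); [apply RInt_0_derive, Sv|].
      auto_derive; auto.
    - rewrite vP; unfold scal, minus, plus, opp; simpl; unfold mult; simpl; ring. }
  rewrite Rplus_0_l, phi0 in K; change (phi (s + P) = phi s + phi P); lra.
Qed.

Lemma RInt_0_multiple (v : R -> R) (P : R) (n : nat) :
  smooth1 v -> (forall r, v (r + P) = v r) ->
  RInt v 0 (INR n * P) = INR n * RInt v 0 P.
Proof.
  intros Sv vP; induction n as [|n IH].
  - simpl; rewrite !Rmult_0_l; apply (RInt_point 0 v).
  - rewrite S_INR, Rmult_plus_distr_r, Rmult_1_l, RInt_0_periodic, IH; auto; simpl; ring.
Qed.

(** The integral of the speed gains the same positive amount over every period, so it is unbounded
    in both directions and onto by the intermediate value theorem. *)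
Lemma periodic_speed_primitive (v : R -> R) (P : R) :
  smooth1 v -> (forall s, 0 < v s) -> 0 < P -> (forall s, v (s + P) = v s) ->
  exists (phi : R -> R) (L : R),
    (forall s, is_derive phi s (v s)) /\ 0 < L /\
    (forall s, phi (s + P) = phi s + L) /\ (forall r, exists s, phi s = r).
Proof.
  intros Sv v0 P0 vP.
  set (phi := (fun s => RInt v 0 s) : R -> R).
  assert (D : forall s, is_derive phi s (v s))
    by (intros s; apply RInt_0_derive, Sv).
  assert (Q : forall s, phi (s + P) = phi s + phi P)
    by (intros s; apply RInt_0_periodic; auto).
  assert (phi0 : phi 0 = 0) by apply (RInt_point 0 v).
  assert (L0 : 0 < phi P)
    by (rewrite <- phi0; apply (positive_derive_lt phi v); auto).
  exists phi, (phi P); split; [|split; [|split]]; auto; intros r.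
  assert (Qn : forall n, phi (INR n * P) = INR n * phi P)
    by (intros n; apply RInt_0_multiple; auto).
  assert (Qm : forall n, phi (- (INR n * P)) = - (INR n * phi P)).
  { intros n; induction n as [|n IH]; [simpl; rewrite !Rmult_0_l, Ropp_0; auto|].
    pose proof (Q (- (INR (S n) * P))) as E.
    replace (- (INR (S n) * P) + P) with (- (INR n * P)) in E
      by (rewrite S_INR; ring).
    rewrite S_INR in *; lra. }
  (* Enough periods for the values at the ends of [-nP, nP] to enclose [r]. *)
  destruct (INR_unbounded (Rabs r / phi P)) as [n Hn].
  assert (Hr : Rabs r < INR n * phi P).
  { apply (Rmult_lt_compat_r (phi P)) in Hn; auto.
    unfold Rdiv in Hn; rewrite Rmult_assoc, Rinv_l in Hn; lra. }
  apply Rabs_def2 in Hr.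
  destruct (IVT_gen phi (- (INR n * P)) (INR n * P) r) as (s & _ & Hs).
  - intros x; apply continuity_pt_filterlim, (ex_derive_continuous phi).
    eexists; apply D.
  - rewrite Qn, Qm, Rmin_left, Rmax_right; lra.
  - exists s; auto.
Qed.

(** * Quaternions *)

Definition add4 (u v : vec4) : vec4 :=
  Vec4 (c0 u + c0 v) (c1 u + c1 v) (c2 u + c2 v) (c3 u + c3 v).
Definition scal4 (r : R) (u : vec4) : vec4 :=
  Vec4 (r * c0 u) (r * c1 u) (r * c2 u) (r * c3 u).

(** The Hamilton product, with [e0] as unit and [e1], [e2], [e3] as the imaginary units. *)
Definition qmul (u v : vec4) : vec4 :=
  Vec4 (c0 u * c0 v - c1 u * c1 v - c2 u * c2 v - c3 u * c3 v)
       (c0 u * c1 v + c1 u * c0 v + c2 u * c3 v - c3 u * c2 v)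
       (c0 u * c2 v + c2 u * c0 v + c3 u * c1 v - c1 u * c3 v)
       (c0 u * c3 v + c3 u * c0 v + c1 u * c2 v - c2 u * c1 v).
Infix "**" := qmul (at level 40, left associativity).

Definition im (u : imq) : vec4 := Vec4 0 (qi u) (qj u) (qk u).

Ltac coord :=
  repeat match goal with
         | u : vec4 |- _ => destruct u
         | u : imq |- _ => destruct u
         end;
  unfold add4, scal4, im, dot4, dot3, cross3, qmul in *; simpl in *.
Ltac vec := coord; f_equal; ring.

Lemma qmulA (a b c : vec4) : a ** (b ** c) = a ** b ** c.
Proof. vec. Qed.

Lemma dot4_mull (a x y : vec4) : dot4 (a ** x) (a ** y) = dot4 a a * dot4 x y.
Proof. coord; ring. Qed.

Lemma dot4_mulr (a x y : vec4) : dot4 (x ** a) (y ** a) = dot4 a a * dot4 x y.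
Proof. coord; ring. Qed.

Lemma dot4_im (u v : imq) : dot4 (im u) (im v) = dot3 u v.
Proof. coord; ring. Qed.

Lemma dot4_eq0 (u : vec4) : dot4 u u = 0 -> u = zero4.
Proof.
  coord; intros H; unfold zero4.
  pose proof (Rle_0_sqr c0) as H0; pose proof (Rle_0_sqr c1) as H1;
  pose proof (Rle_0_sqr c2) as H2; pose proof (Rle_0_sqr c3) as H3.
  unfold Rsqr in *.
  f_equal; apply Rsqr_0_uniq; unfold Rsqr; lra.
Qed.

Lemma dot3_eq0 (u : imq) : dot3 u u = 0 -> u = Imq 0 0 0.
Proof.
  intros H; rewrite <- dot4_im in H; apply dot4_eq0 in H.
  destruct u; injection H as -> -> ->; reflexivity.
Qed.

Lemma dot3_pos (u : imq) : u <> Imq 0 0 0 -> 0 < dot3 u u.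
Proof.
  intros N; destruct (Req_dec (dot3 u u) 0) as [Z|Z].
  - apply dot3_eq0 in Z; contradiction.
  - assert (0 <= dot3 u u); [|lra].
    unfold dot3; pose proof (Rle_0_sqr (qi u)); pose proof (Rle_0_sqr (qj u));
    pose proof (Rle_0_sqr (qk u)); unfold Rsqr in *; lra.
Qed.

Lemma dot3_sym (u v : imq) : dot3 u v = dot3 v u.
Proof. coord; ring. Qed.

(** The square of a triple product is the Gram determinant of the three vectors, here expanded along
    the row of [x]. *)
Lemma gram3 (x u v : imq) :
  dot3 x (cross3 u v) ^ 2 =
  dot3 x x * (dot3 u u * dot3 v v - dot3 u v ^ 2)
  - dot3 x u * (dot3 x u * dot3 v v - dot3 u v * dot3 x v)
  + dot3 x v * (dot3 x u * dot3 u v - dot3 u u * dot3 x v).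
Proof. coord; ring. Qed.

(** The product of two imaginary quaternions is their cross product minus their dot product. *)
Lemma im_cross3 (u v : imq) : dot3 u v = 0 -> im (cross3 u v) = im u ** im v.
Proof. coord; intros H; f_equal; lra. Qed.

(** Conjugation by a unit quaternion preserves the imaginary quaternions; the witness [y] is the
    conjugate of [F] times [u] times [F]. *)
Lemma conj_im (F : vec4) (u : imq) :
  dot4 F F = 1 -> exists x : imq, im u ** F = F ** im x.
Proof.
  intros HF.
  pose (y := Vec4 (c0 F) (- c1 F) (- c2 F) (- c3 F) ** im u ** F).
  assert (E : F ** y = scal4 (dot4 F F) (im u ** F)) by (unfold y; vec).
  assert (E0 : c0 y = 0) by (unfold y; coord; ring).
  exists (Imq (c1 y) (c2 y) (c3 y)).
  transitivity (F ** y); [rewrite E, HF; vec|].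
  f_equal; destruct y; unfold im; simpl in *; rewrite E0; reflexivity.
Qed.

(* If [alpha F = F beta], then [F, alpha F] span the common normal plane on
   which left multiplication by [alpha] and right multiplication by [beta]
   coincide; on the orthogonal plane they are opposite. *)
Lemma tangent_anticomm (F Y : vec4) (a b : imq) :
  dot4 F F = 1 -> im a ** F = F ** im b ->
  dot4 F Y = 0 -> dot4 Y (im a ** F) = 0 ->
  im a ** Y = scal4 (-1) (Y ** im b).
Proof.
  intros HF E H1 H2.
  pose (Fb := Vec4 (c0 F) (- c1 F) (- c2 F) (- c3 F)).
  (* An identity valid for all [F] and [Y]: apply x y* + y x* = 2 <x, y> to the pair Y, F and its
     analogue y* x + x* y = 2 <x, y> to the pair Y, aF, where the star is conjugation. *)
  assert (K : add4 (scal4 (dot4 F F) (im a ** Y)) (Y ** (Fb ** (im a ** F)))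
              = add4 (scal4 (2 * dot4 F Y) (im a ** F))
                     (scal4 (-2 * dot4 Y (im a ** F)) F))
    by (unfold Fb; vec).
  rewrite E in K at 1; rewrite HF, H1, H2 in K.
  assert (K' : Fb ** (F ** im b) = scal4 (dot4 F F) (im b)) by (unfold Fb; vec).
  rewrite K', HF in K; clear - K.
  coord; injection K as K0 K1 K2 K3; f_equal; lra.
Qed.

Lemma qmul_im_scal (F : vec4) (u : imq) (r : R) :
  F ** im (Imq (r * qi u) (r * qj u) (r * qk u)) = scal4 r (F ** im u).
Proof. vec. Qed.

(** The shape left by [im_square_l] and [im_square_r] once the squared length is 1; the factors 1/2,
    -2 and -1 cancel. *)
Lemma scal4_1 (u : vec4) : u = scal4 (/ 2) (scal4 (-2) (scal4 (-1) (scal4 1 u))).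
Proof. coord; f_equal; field. Qed.

Lemma im_square_l (u : imq) (y : vec4) :
  im u ** scal4 (-2) (im u ** y) = scal4 (-2) (scal4 (-1) (scal4 (dot3 u u) y)).
Proof. vec. Qed.

Lemma im_square_r (u : imq) (y : vec4) :
  scal4 (-2) (y ** im u) ** im u = scal4 (-2) (scal4 (-1) (scal4 (dot3 u u) y)).
Proof. vec. Qed.

Lemma half_difference_l (x y z : vec4) :
  add4 x y = z -> y = scal4 (-1) z -> x = scal4 (-2) y.
Proof.
  coord; intros H K.
  injection H as ? ? ? ?; injection K as ? ? ? ?; f_equal; lra.
Qed.

Lemma half_difference_r (x y z : vec4) :
  y = add4 z x -> y = scal4 (-1) z -> x = scal4 (-2) z.
Proof.
  coord; intros H K.
  injection H as ? ? ? ?; injection K as ? ? ? ?; f_equal; lra.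
Qed.

(** The left side is the s-derivative of <TF, FU>, with T' = -a + k aT from the Frenet equation and
    F_s = (1/2) a T F. Keeping the defects [dot3 T T - 1] and [dot3 a T] explicit turns it into a
    polynomial identity free of hypotheses. *)
Lemma cos_s_identity (F : vec4) (a T U : imq) (k : R) :
  dot4 (add4 (add4 (scal4 (-1) (im a)) (scal4 k (im a ** im T)) ** F)
             (im T ** scal4 (/ 2) (im a ** (im T ** F)))) (F ** im U)
  + dot4 (im T ** F) (scal4 (/ 2) (im a ** (im T ** F)) ** im U)
  = - k * dot4 (im T ** F) (im a ** (F ** im U))
    + (dot3 T T - 1) * dot4 (im a ** F) (F ** im U)
    - 2 * dot3 a T * dot4 (im T ** F) (F ** im U).
Proof. coord; field. Qed.

(** The same for the t-derivative, with U' = -b + k bU and F_t = (1/2) F U b. *)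
Lemma cos_t_identity (F : vec4) (T b U : imq) (k : R) :
  dot4 (im T ** scal4 (/ 2) (F ** im U ** im b)) (F ** im U)
  + dot4 (im T ** F) (add4 (scal4 (/ 2) (F ** im U ** im b) ** im U)
       (F ** add4 (scal4 (-1) (im b)) (scal4 k (im b ** im U))))
  = k * dot4 (im T ** F) (F ** (im b ** im U))
    + (dot3 U U - 1) * dot4 (im T ** F) (F ** im b)
    - 2 * dot3 b U * dot4 (im T ** F) (F ** im U).
Proof. coord; field. Qed.

Lemma add4_0r (u v : vec4) : add4 u (v ** zero4) = u.
Proof. unfold zero4; vec. Qed.

Lemma add4_0l (u v : vec4) : add4 (zero4 ** v) u = u.
Proof. unfold zero4; vec. Qed.

(** * The angle between [U] and the vector [T] carried over by conjugation with [F] *)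

Section GaussFrame.

Variables (F : vec4) (a T b U : imq).
Hypothesis F1 : dot4 F F = 1.
Hypothesis aF : im a ** F = F ** im b.
Hypotheses (T1 : dot3 T T = 1) (aT : dot3 a T = 0).
Hypotheses (b1 : dot3 b b = 1) (U1 : dot3 U U = 1) (bU : dot3 b U = 0).

(** Cosine and sine of the angle from [U] to the conjugate of [T] by [F] in the plane orthogonal to
    [b]. Inner products in R^4 avoid naming that conjugate and are easy to differentiate. *)
Definition frame_cos : R := dot4 (im T ** F) (F ** im U).
Definition frame_sin : R := dot4 (im T ** F) (im a ** (F ** im U)).

Lemma frame_sinE : frame_sin = dot4 (im T ** F) (F ** (im b ** im U)).
Proof. unfold frame_sin; rewrite !qmulA, aF; reflexivity. Qed.

Lemma dot_TF_Fb : dot4 (im T ** F) (F ** im b) = 0.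
Proof.
  rewrite <- aF, dot4_mulr, dot4_im.
  rewrite dot3_sym, aT; ring.
Qed.

(** Left multiplication by the unit quaternion [F] is an isometry, so the inner products in R^4
    become inner products with the conjugate [X] of [T] in the tangent plane of the sphere at
    [b]. *)
Lemma frame_conj :
  exists X : imq, im T ** F = F ** im X /\ dot3 X X = 1 /\ dot3 X b = 0 /\
    frame_cos = dot3 X U /\ frame_sin = dot3 X (cross3 b U).
Proof.
  destruct (conj_im F T F1) as [X E]; exists X; split; auto.
  assert (P : forall v, dot3 X v = dot4 (im T ** F) (F ** im v))
    by (intros v; rewrite E, dot4_mull, dot4_im, F1; ring).
  split; [|split; [|split]].
  - rewrite P, <- E, dot4_mulr, F1, dot4_im, T1; ring.
  - rewrite P; apply dot_TF_Fb.
  - symmetry; apply P.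
  - rewrite P, im_cross3, frame_sinE; auto.
Qed.

Lemma frame_cos_sin : frame_cos ^ 2 + frame_sin ^ 2 = 1.
Proof.
  destruct frame_conj as (X & _ & X1 & Xb & -> & ->).
  rewrite gram3, X1, Xb, b1, U1, bU; ring.
Qed.

(** When the sine vanishes, X - cos U has squared length 1 - cos^2 = 0. This is the degenerate case
    that an immersion excludes. *)
Lemma frame_sin_eq0 : frame_sin = 0 -> im T ** F = scal4 frame_cos (F ** im U).
Proof.
  intros S; pose proof frame_cos_sin as CS; rewrite S in CS.
  destruct frame_conj as (X & E & X1 & _ & C & _).
  assert (Z : Imq (qi X - frame_cos * qi U) (qj X - frame_cos * qj U)
                  (qk X - frame_cos * qk U) = Imq 0 0 0).
  { apply dot3_eq0. transitivity (dot3 X X - 2 * frame_cos * dot3 X U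
      + frame_cos ^ 2 * dot3 U U); [unfold dot3; simpl; ring|].
    rewrite X1, U1, <- C; lra. }
  injection Z as Z1 Z2 Z3. rewrite E.
  replace X with (Imq (frame_cos * qi U) (frame_cos * qj U) (frame_cos * qk U))
    by (clear - Z1 Z2 Z3; destruct X; simpl in *; f_equal; lra).
  apply qmul_im_scal.
Qed.

(** Here [T] plays the derivative of [a] and [dF] that of [F] in the first null variable. The
    derivative of aF = Fb reads TF + a dF = dF b, and dF b = -a dF by anticommutation, so TF = -2 a
    dF; left multiplication by [a] finishes, since a^2 = -1. *)
Lemma frame_partial_s (dF : vec4) :
  dot4 F dF = 0 -> dot4 dF (im a ** F) = 0 ->
  add4 (im T ** F) (im a ** dF) = dF ** im b ->
  dot3 a a = 1 ->
  dF = scal4 (/ 2) (im a ** (im T ** F)).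
Proof.
  intros H1 H2 H3 a1.
  pose proof (tangent_anticomm F dF a b F1 aF H1 H2) as H.
  rewrite (half_difference_l _ _ _ H3 H).
  rewrite im_square_l, a1; apply scal4_1.
Qed.

(** Mirror image for the second null variable: FU = -2 dF b, then right multiplication by [b]. *)
Lemma frame_partial_t (dF : vec4) :
  dot4 F dF = 0 -> dot4 dF (im a ** F) = 0 ->
  im a ** dF = add4 (dF ** im b) (F ** im U) ->
  dF = scal4 (/ 2) (F ** im U ** im b).
Proof.
  intros H1 H2 H3.
  pose proof (tangent_anticomm F dF a b F1 aF H1 H2) as H.
  rewrite (half_difference_r _ _ _ H3 H).
  rewrite im_square_r, b1; apply scal4_1.
Qed.

Lemma frame_cos_s (k : R) :
  dot4 (add4 (add4 (scal4 (-1) (im a)) (scal4 k (im a ** im T)) ** F)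
             (im T ** scal4 (/ 2) (im a ** (im T ** F)))) (F ** im U)
  + dot4 (im T ** F) (scal4 (/ 2) (im a ** (im T ** F)) ** im U)
  = - k * frame_sin.
Proof.
  transitivity (- k * frame_sin + (dot3 T T - 1) * dot4 (im a ** F) (F ** im U)
                - 2 * dot3 a T * frame_cos).
  - apply cos_s_identity.
  - rewrite T1, aT; ring.
Qed.

Lemma frame_cos_t (k : R) :
  dot4 (im T ** scal4 (/ 2) (F ** im U ** im b)) (F ** im U)
  + dot4 (im T ** F) (add4 (scal4 (/ 2) (F ** im U ** im b) ** im U)
       (F ** add4 (scal4 (-1) (im b)) (scal4 k (im b ** im U))))
  = k * frame_sin.
Proof.
  rewrite frame_sinE.
  transitivity (k * dot4 (im T ** F) (F ** (im b ** im U))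
     + (dot3 U U - 1) * dot4 (im T ** F) (F ** im b) - 2 * dot3 b U * frame_cos).
  - apply cos_t_identity.
  - rewrite U1, bU; ring.
Qed.

End GaussFrame.

(** * Calculus for vector-valued functions *)

Definition is_derive3 (f : R -> imq) (x : R) (l : imq) : Prop :=
  is_derive (fun r => qi (f r)) x (qi l) /\ is_derive (fun r => qj (f r)) x (qj l) /\
  is_derive (fun r => qk (f r)) x (qk l).

Definition is_derive4 (f : R -> vec4) (x : R) (l : vec4) : Prop :=
  is_derive (fun r => c0 (f r)) x (c0 l) /\ is_derive (fun r => c1 (f r)) x (c1 l) /\
  is_derive (fun r => c2 (f r)) x (c2 l) /\ is_derive (fun r => c3 (f r)) x (c3 l).

Lemma is_derive_Rplus (f g : R -> R) (x l m : R) :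
  is_derive f x l -> is_derive g x m -> is_derive (fun t => f t + g t) x (l + m).
Proof. apply (is_derive_plus (V := R_NormedModule)). Qed.

Lemma is_derive_Rminus (f g : R -> R) (x l m : R) :
  is_derive f x l -> is_derive g x m -> is_derive (fun t => f t - g t) x (l - m).
Proof. apply (is_derive_minus (V := R_NormedModule)). Qed.

Ltac derive_step :=
  lazymatch goal with
  | |- is_derive (fun r => _ + _) _ _ => eapply is_derive_Rplus
  | |- is_derive (fun r => _ - _) _ _ => eapply is_derive_Rminus
  | |- is_derive (fun r => _ * _) _ _ => eapply Derive.is_derive_mult
  | _ => eassumption
  end.
Ltac derive_poly := eapply eq_derive; [repeat derive_step | simpl; ring].

Lemma is_derive_dot3 (f g : R -> imq) (x : R) (l m : imq) :
  is_derive3 f x l -> is_derive3 g x m ->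
  is_derive (fun r => dot3 (f r) (g r)) x (dot3 l (g x) + dot3 (f x) m).
Proof.
  intros (? & ? & ?) (? & ? & ?); unfold dot3; derive_poly.
Qed.

Lemma is_derive_dot4 (f g : R -> vec4) (x : R) (l m : vec4) :
  is_derive4 f x l -> is_derive4 g x m ->
  is_derive (fun r => dot4 (f r) (g r)) x (dot4 l (g x) + dot4 (f x) m).
Proof.
  intros (? & ? & ? & ?) (? & ? & ? & ?); unfold dot4; derive_poly.
Qed.

Lemma is_derive4_qmul (f g : R -> vec4) (x : R) (l m : vec4) :
  is_derive4 f x l -> is_derive4 g x m ->
  is_derive4 (fun r => f r ** g r) x (add4 (l ** g x) (f x ** m)).
Proof.
  intros (? & ? & ? & ?) (? & ? & ? & ?).
  split; [|split; [|split]]; simpl; derive_poly.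
Qed.

Lemma is_derive4_const (u : vec4) (x : R) : is_derive4 (fun _ => u) x zero4.
Proof.
  split; [|split; [|split]]; apply (is_derive_const (V := R_NormedModule)).
Qed.

Lemma is_derive4_im (f : R -> imq) (x : R) (l : imq) :
  is_derive3 f x l -> is_derive4 (fun r => im (f r)) x (im l).
Proof.
  intros (? & ? & ?); split; [|split; [|split]]; auto.
  exact (is_derive_const (V := R_NormedModule) 0 x).
Qed.

Lemma is_derive4_unique (f g : R -> vec4) (x : R) (l m : vec4) :
  (forall r, f r = g r) -> is_derive4 f x l -> is_derive4 g x m -> l = m.
Proof.
  intros E (? & ? & ? & ?) (? & ? & ? & ?); destruct l, m; simpl in *; f_equal;
  (etransitivity; [symmetry; apply is_derive_unique; eassumption|];
   etransitivity; [|apply is_derive_unique; eassumption];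
   apply Derive_ext; intros; rewrite E; reflexivity).
Qed.

Lemma is_derive_const_eq (f : R -> R) (x c l : R) :
  (forall r, f r = c) -> is_derive f x l -> l = 0.
Proof.
  intros E H; rewrite <- (is_derive_unique _ _ _ H), <- (Derive_const c x).
  apply Derive_ext, E.
Qed.

(** * Curves in the sphere *)

Definition smooth3 (c : R -> imq) : Prop :=
  smooth1 (fun s => qi (c s)) /\ smooth1 (fun s => qj (c s)) /\
  smooth1 (fun s => qk (c s)).

Lemma smooth3_ext (c d : R -> imq) : (forall s, c s = d s) -> smooth3 c -> smooth3 d.
Proof.
  intros E (H1 & H2 & H3); split; [|split];
    [refine (smooth1_ext _ _ _ H1)|refine (smooth1_ext _ _ _ H2)
    |refine (smooth1_ext _ _ _ H3)]; intros s; rewrite E; reflexivity.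
Qed.

Lemma smooth3_deriv (c : R -> imq) : smooth3 c -> smooth3 (deriv3 1 c).
Proof. intros (H1 & H2 & H3); split; [|split]; apply smooth1_Derive; auto. Qed.

Lemma smooth3_is_derive (c : R -> imq) (s : R) :
  smooth3 c -> is_derive3 c s (deriv3 1 c s).
Proof.
  intros (H1 & H2 & H3); split; [|split]; apply Derive_correct;
    apply smooth1_ex_derive; auto.
Qed.

Lemma smooth3_is_derive2 (c : R -> imq) (s : R) :
  smooth3 c -> is_derive3 (deriv3 1 c) s (deriv3 2 c s).
Proof. intros H; apply (smooth3_is_derive _ s (smooth3_deriv c H)). Qed.

Lemma smooth1_dot3 (c d : R -> imq) :
  smooth3 c -> smooth3 d -> smooth1 (fun s => dot3 (c s) (d s)).
Proof. intros (? & ? & ?) (? & ? & ?); unfold dot3; auto with smooth. Qed.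

Lemma smooth3_cross3 (c d : R -> imq) :
  smooth3 c -> smooth3 d -> smooth3 (fun s => cross3 (c s) (d s)).
Proof.
  intros (? & ? & ?) (? & ? & ?); split; [|split]; simpl; auto with smooth.
Qed.

Lemma smooth1_geod_curv (c : R -> imq) : smooth3 c -> smooth1 (geod_curv c).
Proof.
  intros H; apply smooth1_dot3.
  - apply (smooth3_deriv (deriv3 1 c)), smooth3_deriv, H.
  - apply smooth3_cross3; auto; apply smooth3_deriv, H.
Qed.

(** The residual [z] is orthogonal to [u], [v] and their cross product, so [gram3] reduces to
    [dot3 z z = 0]. *)
Lemma orthonormal_expansion (u v w : imq) :
  dot3 u u = 1 -> dot3 v v = 1 -> dot3 u v = 0 ->
  im w = add4 (add4 (scal4 (dot3 w u) (im u)) (scal4 (dot3 w v) (im v)))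
              (scal4 (dot3 w (cross3 u v)) (im (cross3 u v))).
Proof.
  intros Hu Hv Huv.
  set (n := cross3 u v); set (wu := dot3 w u); set (wv := dot3 w v).
  set (wn := dot3 w n).
  set (z := Imq (qi w - wu * qi u - wv * qi v - wn * qi n)
                (qj w - wu * qj u - wv * qj v - wn * qj n)
                (qk w - wu * qk u - wv * qk v - wn * qk n)).
  assert (Dz : forall y, dot3 z y = dot3 w y - wu * dot3 u y - wv * dot3 v y
                                    - wn * dot3 n y)
    by (intros y; unfold dot3, z; simpl; ring).
  assert (nu : dot3 n u = 0) by (unfold n, dot3, cross3; simpl; ring).
  assert (nv : dot3 n v = 0) by (unfold n, dot3, cross3; simpl; ring).
  assert (nn : dot3 n n = 1).
  { transitivity (dot3 u u * dot3 v v - dot3 u v ^ 2).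
    - unfold n, dot3, cross3; simpl; ring.
    - rewrite Hu, Hv, Huv; ring. }
  assert (zu : dot3 z u = 0).
  { rewrite Dz, Hu, (dot3_sym v u), Huv, nu; unfold wu; ring. }
  assert (zv : dot3 z v = 0) by (rewrite Dz, Huv, Hv, nv; unfold wv; ring).
  assert (zn : dot3 z n = 0).
  { rewrite Dz, (dot3_sym u n), (dot3_sym v n), nu, nv, nn; unfold wn; ring. }
  pose proof (gram3 z u v) as G; fold n in G.
  rewrite zn, zu, zv, Hu, Hv, Huv in G.
  assert (Z : z = Imq 0 0 0) by (apply dot3_eq0; lra).
  injection Z as Z1 Z2 Z3.
  unfold add4, scal4, im; simpl; f_equal; lra.
Qed.

(** Differentiating |c|^2 = 1 twice and |c'|^2 = 1 once gives the components of c'' along c and c';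
    the component along the cross product of c and c' is the geodesic curvature by definition. *)
Lemma frenet (c : R -> imq) (s : R) :
  smooth3 c -> (forall r, in_S2 (c r)) ->
  (forall r, dot3 (deriv3 1 c r) (deriv3 1 c r) = 1) ->
  dot3 (c s) (deriv3 1 c s) = 0 /\
  im (deriv3 2 c s) =
    add4 (scal4 (-1) (im (c s)))
         (scal4 (geod_curv c s) (im (c s) ** im (deriv3 1 c s))).
Proof.
  intros Sm S2 U.
  assert (O : forall r, dot3 (c r) (deriv3 1 c r) = 0).
  { intros r. pose proof (smooth3_is_derive c r Sm) as D.
    pose proof (is_derive_const_eq _ _ 1 _ S2 (is_derive_dot3 _ _ _ _ _ D D)) as K.
    rewrite (dot3_sym (deriv3 1 c r)) in K; lra. }
  pose proof (smooth3_is_derive c s Sm) as D1.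
  pose proof (smooth3_is_derive2 c s Sm) as D2.
  pose proof (is_derive_const_eq _ _ 0 _ O (is_derive_dot3 _ _ _ _ _ D1 D2)) as K1.
  pose proof (is_derive_const_eq _ _ 1 _ U (is_derive_dot3 _ _ _ _ _ D2 D2)) as K2.
  split; [apply O|].
  rewrite (orthonormal_expansion (c s) (deriv3 1 c s)); auto; [|apply S2].
  rewrite <- im_cross3 by apply O. unfold geod_curv.
  replace (dot3 (deriv3 2 c s) (c s)) with (-1)
    by (rewrite dot3_sym, U in *; lra).
  replace (dot3 (deriv3 2 c s) (deriv3 1 c s)) with 0
    by (rewrite (dot3_sym (deriv3 1 c s)) in K2; lra).
  generalize (im (c s)) (im (deriv3 1 c s)) (im (cross3 (c s) (deriv3 1 c s))).
  clear; intros x y z; vec.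
Qed.

(** * The angle between the asymptotic directions *)

Lemma nonvanishing_same_sign (f : R -> R) (x y : R) :
  (forall r, ex_derive f r) -> (forall r, f r <> 0) -> 0 < f x * f y.
Proof.
  intros D N.
  destruct (Rlt_or_le 0 (f x * f y)) as [H|H]; auto; exfalso.
  destruct (IVT_gen f x y 0) as (z & _ & Hz).
  - intros r; apply continuity_pt_filterlim, (ex_derive_continuous f), D.
  - unfold Rmin, Rmax; destruct (Rle_dec (f x) (f y)); split; nra.
  - exact (N z Hz).
Qed.

Lemma is_derive_acos (f : R -> R) (x l : R) :
  is_derive f x l -> -1 < f x < 1 ->
  is_derive (fun r => acos (f r)) x (- l / sqrt (1 - f x ^ 2)).
Proof.
  intros D H; eapply eq_derive.
  - apply (is_derive_comp acos f); [|exact D].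
    apply is_derive_Reals.
    apply (derive_pt_eq_1 _ _ _ (derivable_pt_acos _ H)), derive_pt_acos.
  - unfold scal; simpl; unfold mult; simpl; unfold Rsqr, Rdiv.
    rewrite Rmult_1_r; ring.
Qed.

Lemma RInt_primitive (f df : R -> R) (a b : R) :
  (forall x, is_derive f x (df x)) -> smooth1 df -> RInt df a b = f b - f a.
Proof.
  intros D S; apply is_RInt_unique.
  apply (is_RInt_derive (V := R_CompleteNormedModule) f df); intros; auto.
  apply smooth1_continuous, S.
Qed.

Section Angle.

Variables (F Fs Ft : R -> R -> vec4) (g1 g2 : R -> imq).
Hypothesis Fs_derive : forall s t, is_derive4 (fun r => F r t) s (Fs s t).
Hypothesis Ft_derive : forall s t, is_derive4 (fun r => F s r) t (Ft s t).
Hypothesis F_unit : forall s t, dot4 (F s t) (F s t) = 1.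
Hypothesis F_conj : forall s t, im (g1 s) ** F s t = F s t ** im (g2 t).
Hypothesis Fs_tangent : forall s t, dot4 (Fs s t) (im (g1 s) ** F s t) = 0.
Hypothesis Ft_tangent : forall s t, dot4 (Ft s t) (im (g1 s) ** F s t) = 0.
Hypothesis Fst_indep : forall s t r, Fs s t <> scal4 r (Ft s t).
Hypotheses (g1_smooth : smooth3 g1) (g2_smooth : smooth3 g2).
Hypotheses (g1_S2 : forall s, in_S2 (g1 s)) (g2_S2 : forall s, in_S2 (g2 s)).
Hypothesis g1_unit : forall s, dot3 (deriv3 1 g1 s) (deriv3 1 g1 s) = 1.
Hypothesis g2_unit : forall s, dot3 (deriv3 1 g2 s) (deriv3 1 g2 s) = 1.

Let T s := deriv3 1 g1 s.
Let U t := deriv3 1 g2 t.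
(** Cosine and sine of the angle omega(s, t). *)
Let p s t := frame_cos (F s t) (T s) (U t).
Let q s t := frame_sin (F s t) (g1 s) (T s) (U t).

Lemma g1_ortho (s : R) : dot3 (g1 s) (T s) = 0.
Proof. apply (frenet g1 s g1_smooth g1_S2 g1_unit). Qed.

Lemma g2_ortho (t : R) : dot3 (g2 t) (U t) = 0.
Proof. apply (frenet g2 t g2_smooth g2_S2 g2_unit). Qed.

Lemma Fs_ortho (s t : R) : dot4 (F s t) (Fs s t) = 0.
Proof.
  pose proof (is_derive_dot4 _ _ _ _ _ (Fs_derive s t) (Fs_derive s t)) as D.
  apply (is_derive_const_eq _ _ 1) in D; [|intros; apply F_unit].
  unfold dot4 in *; lra.
Qed.

Lemma Ft_ortho (s t : R) : dot4 (F s t) (Ft s t) = 0.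
Proof.
  pose proof (is_derive_dot4 _ _ _ _ _ (Ft_derive s t) (Ft_derive s t)) as D.
  apply (is_derive_const_eq _ _ 1) in D; [|intros; apply F_unit].
  unfold dot4 in *; lra.
Qed.

Lemma FsE (s t : R) : Fs s t = scal4 (/ 2) (im (g1 s) ** (im (T s) ** F s t)).
Proof.
  apply (frame_partial_s (F s t) (g1 s) (T s) (g2 t)); auto using Fs_ortho.
  - pose proof (is_derive4_qmul _ _ _ _ _
      (is_derive4_im _ _ _ (smooth3_is_derive g1 s g1_smooth)) (Fs_derive s t)) as D1.
    pose proof (is_derive4_qmul _ _ _ _ _
      (Fs_derive s t) (is_derive4_const (im (g2 t)) s)) as D2.
    rewrite add4_0r in D2.
    apply (is_derive4_unique _ _ _ _ _ (fun r => F_conj r t) D1 D2).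
  - apply g1_S2.
Qed.

Lemma FtE (s t : R) : Ft s t = scal4 (/ 2) (F s t ** im (U t) ** im (g2 t)).
Proof.
  apply (frame_partial_t (F s t) (g1 s) (g2 t) (U t)); auto using Ft_ortho.
  - apply g2_S2.
  - pose proof (is_derive4_qmul _ _ _ _ _ (Ft_derive s t)
      (is_derive4_im _ _ _ (smooth3_is_derive g2 t g2_smooth))) as D1.
    pose proof (is_derive4_qmul _ _ _ _ _
      (is_derive4_const (im (g1 s)) t) (Ft_derive s t)) as D2.
    rewrite add4_0l in D2.
    apply (is_derive4_unique _ _ _ _ _ (fun r => F_conj s r) D2 D1).
Qed.

(** In terms of the angle: the s-derivative of omega is the geodesic curvature of [g1]. *)
Lemma p_derive_s (s t : R) :
  is_derive (fun r => p r t) s (- geod_curv g1 s * q s t).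
Proof.
  eapply eq_derive.
  - apply is_derive_dot4; apply is_derive4_qmul.
    + apply is_derive4_im, smooth3_is_derive2, g1_smooth.
    + apply Fs_derive.
    + apply Fs_derive.
    + apply is_derive4_const.
  - rewrite add4_0r, FsE, (proj2 (frenet g1 s g1_smooth g1_S2 g1_unit)).
    apply (frame_cos_s (F s t) (g1 s) (T s) (U t)).
    + apply g1_unit.
    + apply g1_ortho.
Qed.

(** In terms of the angle: the t-derivative of omega is minus the geodesic curvature of [g2]. *)
Lemma p_derive_t (s t : R) :
  is_derive (fun r => p s r) t (geod_curv g2 t * q s t).
Proof.
  eapply eq_derive.
  - apply is_derive_dot4; apply is_derive4_qmul.
    + apply is_derive4_const.
    + apply Ft_derive.
    + apply Ft_derive.
    + apply is_derive4_im, smooth3_is_derive2, g2_smooth.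
  - rewrite add4_0l, FtE, (proj2 (frenet g2 t g2_smooth g2_S2 g2_unit)).
    apply (frame_cos_t (F s t) (g1 s) (T s) (g2 t) (U t));
      [apply F_conj|apply g2_unit|apply g2_ortho].
Qed.

Lemma q_ex_derive_s (s t : R) : ex_derive (fun r => q r t) s.
Proof.
  unfold q, frame_sin; eexists; eapply is_derive_dot4; eapply is_derive4_qmul.
  - apply is_derive4_im, smooth3_is_derive2, g1_smooth.
  - apply Fs_derive.
  - apply is_derive4_im, smooth3_is_derive, g1_smooth.
  - eapply is_derive4_qmul; [apply Fs_derive|apply is_derive4_const].
Qed.

Lemma q_ex_derive_t (s t : R) : ex_derive (fun r => q s r) t.
Proof.
  unfold q, frame_sin; eexists; eapply is_derive_dot4; eapply is_derive4_qmul.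
  - apply is_derive4_const.
  - apply Ft_derive.
  - apply is_derive4_const.
  - eapply is_derive4_qmul; [apply Ft_derive|].
    apply is_derive4_im, smooth3_is_derive2, g2_smooth.
Qed.

Lemma pq_sq (s t : R) : p s t ^ 2 + q s t ^ 2 = 1.
Proof.
  apply (frame_cos_sin (F s t) (g1 s) (T s) (g2 t) (U t));
    [apply F_unit|apply F_conj|apply g1_unit|apply g1_ortho|apply g2_S2
    |apply g2_unit|apply g2_ortho].
Qed.

(** If sin omega vanished, TF would equal p FU, and the formulas for the partial derivatives would
    give F_s = -p F_t, against [Fst_indep]. *)
Lemma q_neq0 (s t : R) : q s t <> 0.
Proof.
  intros Q.
  pose proof (frame_sin_eq0 (F s t) (g1 s) (T s) (g2 t) (U t) (F_unit s t)
    (F_conj s t) (g1_unit s) (g1_ortho s) (g2_S2 t) (g2_unit t) (g2_ortho t) Q) as E.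
  apply (Fst_indep s t (- p s t)). rewrite FsE, FtE, E; fold (p s t).
  (* [g1] crosses [F] and becomes right multiplication by [g2]; the sign of -p then comes from [g2]
     and [U] anticommuting. *)
  assert (K : im (g1 s) ** scal4 (p s t) (F s t ** im (U t))
              = scal4 (p s t) (F s t ** (im (g2 t) ** im (U t)))).
  { rewrite (qmulA (F s t)), <- F_conj, <- qmulA. clear; vec. }
  rewrite K, <- qmulA, <- im_cross3 by apply g2_ortho.
  replace (im (U t) ** im (g2 t)) with (scal4 (-1) (im (cross3 (g2 t) (U t)))).
  - generalize (p s t) (F s t) (im (cross3 (g2 t) (U t))). clear; intros; vec.
  - pose proof (g2_ortho t) as O; revert O; generalize (g2 t) (U t).
    clear; intros b u O. coord; f_equal; lra.
Qed.

(** With [e] the sign of sin omega, omega = e acos p is globally defined. The difference of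
    integrals is its increment from (a, c) to (b, d), and both values lie in (0, pi) or both in
    (-pi, 0). *)
Lemma angle_bound (a b c d : R) :
  - PI < RInt (geod_curv g1) a b - RInt (geod_curv g2) c d < PI.
Proof.
  (* The sign of [q] is constant: it is kept from (0, 0) to (s, 0), and from there to (s, t). *)
  assert (E : exists e, e ^ 2 = 1 /\ forall s t, 0 < e * q s t).
  { assert (P : forall s t, 0 < q 0 0 * q s t).
    { intros s t.
      pose proof (nonvanishing_same_sign (fun r => q r 0) 0 s
        (fun r => q_ex_derive_s r 0) (fun r => q_neq0 r 0)) as H1.
      pose proof (nonvanishing_same_sign (fun r => q s r) 0 t
        (q_ex_derive_t s) (q_neq0 s)) as H2.
      simpl in H1, H2. pose proof (Rmult_lt_0_compat _ _ H1 H2).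
      pose proof (pow2_gt_0 _ (q_neq0 s 0)). nra. }
    pose proof (q_neq0 0 0) as N.
    destruct (Rlt_or_le 0 (q 0 0)) as [L|L]; [exists 1|exists (-1)];
      (split; [ring|]); intros s t; specialize (P s t); nra. }
  destruct E as (e & e2 & eq0).
  assert (pI : forall s t, -1 < p s t < 1).
  { intros s t; pose proof (pq_sq s t).
    pose proof (pow2_gt_0 _ (q_neq0 s t)); nra. }
  assert (sq : forall s t, sqrt (1 - p s t ^ 2) = e * q s t).
  { intros s t. replace (1 - p s t ^ 2) with ((e * q s t) ^ 2).
    - apply sqrt_pow2; left; apply eq0.
    - rewrite Rpow_mult_distr, e2; pose proof (pq_sq s t); lra. }
  assert (e0 : e <> 0) by (intros ->; lra).
  assert (Ds : forall s t, is_derive (fun r => e * acos (p r t)) s (geod_curv g1 s)).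
  { intros s t; eapply eq_derive.
    - apply is_derive_scal, is_derive_acos; [apply p_derive_s|apply pI].
    - cbv beta; rewrite sq; field.
      split; [apply q_neq0|exact e0]. }
  assert (Dt : forall s t, is_derive (fun r => - e * acos (p s r)) t (geod_curv g2 t)).
  { intros s t; eapply eq_derive.
    - apply is_derive_scal, is_derive_acos; [apply p_derive_t|apply pI].
    - cbv beta; rewrite sq; field.
      split; [apply q_neq0|exact e0]. }
  (* The first integral runs along t = d and the second along s = a, so that the values at (a, d)
     cancel. *)
  rewrite (RInt_primitive _ _ a b (fun s => Ds s d) (smooth1_geod_curv _ g1_smooth)).
  rewrite (RInt_primitive _ _ c d (fun t => Dt a t) (smooth1_geod_curv _ g2_smooth)).
  pose proof (acos_bound_lt _ (pI b d)); pose proof (acos_bound_lt _ (pI a c)).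
  assert (e = 1 \/ e = -1) as [-> | ->] by
    (destruct (Rle_or_lt 0 e); [left|right]; nra).
  - lra.
  - lra.
Qed.

End Angle.

(** * Smooth functions on the Lorentz plane *)

Definition dx (f : lorentz -> R) (z : lorentz) : R :=
  Derive (fun a => f (a, snd z)) (fst z).
Definition dy (f : lorentz -> R) (z : lorentz) : R :=
  Derive (fun b => f (fst z, b)) (snd z).

Lemma smooth_dx (f : lorentz -> R) : smooth f -> smooth (dx f).
Proof. intros H n x y; apply (H (S n) x y). Qed.

Lemma smooth_dy (f : lorentz -> R) : smooth f -> smooth (dy f).
Proof. intros H n x y; apply (H (S n) x y). Qed.

(** Partial derivatives give total differentiability once one of them is continuous; here it is
    [dx f], whose continuity is order 0 of [smooth_dx]. *)
Lemma smooth_differentiable (f : lorentz -> R) (x y : R) :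
  smooth f ->
  differentiable_pt_lim (fun a b => f (a, b)) x y (dx f (x, y)) (dy f (x, y)).
Proof.
  intros H; apply filterdiff_differentiable_pt_lim.
  apply (is_derive_filterdiff (fun a b => f (a, b)) x y
           (fun a b => dx f (a, b)) (dy f (x, y))).
  - exists (mkposreal _ Rlt_0_1); intros [a b] _; apply Derive_correct.
    apply (H 1%nat a b).
  - apply Derive_correct, (H 1%nat x y).
  - apply (continuity_2d_pt_filterlim (fun a b => dx f (a, b)) x y).
    apply (smooth_dx f H 0%nat x y).
Qed.

Lemma smooth_chain (f : lorentz -> R) (u v : R -> R) (t du dv : R) :
  smooth f -> is_derive u t du -> is_derive v t dv ->
  is_derive (fun r => f (u r, v r)) t
    (dx f (u t, v t) * du + dy f (u t, v t) * dv).
Proof.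
  rewrite !is_derive_Reals; intros H Hu Hv.
  apply (derivable_pt_lim_comp_2d (fun a b => f (a, b)) u v); auto.
  apply smooth_differentiable, H.
Qed.

Definition line (z u : lorentz) (h : R) : lorentz := Lplus z (Lscal h u).

Lemma smooth_line_derive (f : lorentz -> R) (z u : lorentz) (h : R) :
  smooth f ->
  is_derive (fun r => f (line z u r)) h
    (dx f (line z u h) * fst u + dy f (line z u h) * snd u).
Proof.
  intros H.
  apply (smooth_chain f (fun r => fst z + r * fst u) (fun r => snd z + r * snd u));
    auto; auto_derive; auto; ring.
Qed.

(** The derivative along a line combines [dx f] and [dy f] on the same line with constant
    coefficients, so the induction runs over all smooth [f]. *)
Lemma smooth_line (f : lorentz -> R) (z u : lorentz) :
  smooth f -> smooth1 (fun h => f (line z u h)).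
Proof.
  intros H; apply smooth1_iff; intros n; revert f H.
  induction n as [|n IH]; intros f H; simpl; auto; split.
  - intros h; eexists; apply smooth_line_derive, H.
  - apply (differentiable_n_ext n (fun h =>
      dx f (line z u h) * fst u + dy f (line z u h) * snd u)).
    + intros h; symmetry; apply is_derive_unique, smooth_line_derive, H.
    + apply differentiable_n_plus; apply differentiable_n_mult;
        auto using differentiable_n_const, smooth_dx, smooth_dy.
Qed.

Lemma line_0 (z u : lorentz) : line z u 0 = z.
Proof.
  destruct z, u; unfold line, Lplus, Lscal; simpl; f_equal; ring.
Qed.

Lemma smooth_diff (f : lorentz -> R) (z u : lorentz) :
  smooth f -> diff f z u = dx f z * fst u + dy f z * snd u.
Proof.
  intros H; apply is_derive_unique.
  pose proof (smooth_line_derive f z u 0 H) as D; rewrite line_0 in D; exact D.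
Qed.

(** [diff] at a point of the line is a derivative at 0 of the line restarted there, hence the
    smoothness hypothesis on the restarted line and the shift by [h]. *)
Lemma line_derive (f : lorentz -> R) (z u : lorentz) (h : R) :
  smooth1 (fun r => f (line (line z u h) u r)) ->
  is_derive (fun r => f (line z u r)) h (diff f (line z u h) u).
Proof.
  intros H.
  assert (D : is_derive (fun r => f (line (line z u h) u (r - h))) h
                (1 * diff f (line z u h) u)).
  { apply (is_derive_comp (V := R_NormedModule)
             (fun r => f (line (line z u h) u r)) (fun r => r - h)).
    - rewrite Rminus_diag; apply Derive_correct, (smooth1_ex_derive _ 0 H).
    - auto_derive; auto. }
  rewrite Rmult_1_l in D.
  refine (is_derive_ext _ _ _ _ _ D); intros r; f_equal.
  unfold line, Lplus, Lscal; simpl; f_equal; ring.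
Qed.

(** Assumes smoothness along a single line, the form in which the regularity of [G] is
    established. *)
Lemma diff_opp (f : lorentz -> R) (z u v : lorentz) :
  smooth1 (fun r => f (line z u r)) -> v = Lscal (-1) u ->
  diff f z v = - diff f z u.
Proof.
  intros H ->; apply is_derive_unique.
  assert (D : is_derive (fun r => f (line z u (- r))) 0 (-1 * diff f z u)).
  { apply (is_derive_comp (V := R_NormedModule)
             (fun r => f (line z u r)) (fun r => - r)).
    - rewrite Ropp_0; apply Derive_correct, (smooth1_ex_derive _ 0 H).
    - auto_derive; auto. }
  replace (- diff f z u) with (-1 * diff f z u) by ring.
  refine (is_derive_ext _ _ _ _ _ D); intros r; f_equal.
  unfold line, Lplus, Lscal; simpl; f_equal; ring.
Qed.

Lemma dx_periodic (f : lorentz -> R) (g z : lorentz) :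
  (forall z, f (Lplus z g) = f z) -> dx f (Lplus z g) = dx f z.
Proof.
  intros H; destruct z as [x y], g as [a b]; unfold dx; simpl.
  change (Derive_n (fun r => f (r, y + b)) 1 (x + a) = Derive_n (fun r => f (r, y)) 1 x).
  rewrite <- Derive_n_comp_trans; apply Derive_n_ext; intros r; apply (H (r, y)).
Qed.

Lemma dy_periodic (f : lorentz -> R) (g z : lorentz) :
  (forall z, f (Lplus z g) = f z) -> dy f (Lplus z g) = dy f z.
Proof.
  intros H; destruct z as [x y], g as [a b]; unfold dy; simpl.
  change (Derive_n (fun r => f (x + a, r)) 1 (y + b) = Derive_n (fun r => f (x, r)) 1 y).
  rewrite <- Derive_n_comp_trans; apply Derive_n_ext; intros r; apply (H (x, r)).
Qed.

Lemma line_x (s : R) : line (0, 0) (1, 0) s = (s, 0).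
Proof. unfold line, Lplus, Lscal; simpl; f_equal; ring. Qed.

(** Serves the self-dual components of [G] with e = 1 and the anti-self-dual ones with e = -1. *)
Lemma sum_line_const (f g : lorentz -> R) (e : R) (z u : lorentz) :
  (forall z, smooth1 (fun h => f (line z u h))) ->
  (forall z, smooth1 (fun h => g (line z u h))) ->
  (forall z, diff f z u + e * diff g z u = 0) ->
  forall h, f (line z u h) + e * g (line z u h) = f z + e * g z.
Proof.
  intros Sf Sg E h.
  rewrite <- (line_0 z u) at 3 4.
  apply (zero_derive_const (fun h => f (line z u h) + e * g (line z u h))).
  intros t; rewrite <- (E (line z u t)).
  apply is_derive_Rplus; [|apply is_derive_scal]; apply line_derive; auto.
Qed.

(** * Arc length parametrization *)

Lemma periodic_deriv3 (c : R -> imq) (P s : R) (n : nat) :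
  (forall r, c (r + P) = c r) -> deriv3 n c (s + P) = deriv3 n c s.
Proof.
  intros H; unfold deriv3; f_equal; rewrite <- Derive_n_comp_trans;
    apply Derive_n_ext; intros r; rewrite H; reflexivity.
Qed.

Lemma periodic_geod_curv (c : R -> imq) (P s : R) :
  (forall r, c (r + P) = c r) -> geod_curv c (s + P) = geod_curv c s.
Proof. intros H; unfold geod_curv; rewrite H, !periodic_deriv3; auto. Qed.

Lemma smooth3_comp (c : R -> imq) (u : R -> R) :
  smooth3 c -> smooth1 u -> smooth3 (fun s => c (u s)).
Proof.
  intros (H1 & H2 & H3) Hu; split; [|split].
  - apply (smooth1_comp (fun s => qi (c s)) u H1 Hu).
  - apply (smooth1_comp (fun s => qj (c s)) u H2 Hu).
  - apply (smooth1_comp (fun s => qk (c s)) u H3 Hu).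
Qed.

Lemma deriv3_comp (c : R -> imq) (u : R -> R) (s : R) :
  smooth3 c -> smooth1 u ->
  dot3 (deriv3 1 (fun r => c (u r)) s) (deriv3 1 (fun r => c (u r)) s) =
  Derive u s ^ 2 * dot3 (deriv3 1 c (u s)) (deriv3 1 c (u s)).
Proof.
  intros (H1 & H2 & H3) Hu.
  assert (E : forall f, smooth1 f ->
    Derive (fun r => f (u r)) s = Derive u s * Derive f (u s))
    by (intros f Hf; apply Derive_comp; apply smooth1_ex_derive; auto).
  unfold dot3, deriv3; simpl.
  rewrite (E _ H1), (E _ H2), (E _ H3).
  change (Derive (fun x => qi (c x))) with (Derive (fun r => qi (c r))). ring.
Qed.

Lemma positive_period (c : R -> imq) (P : R) :
  P <> 0 -> (forall s, c (s + P) = c s) -> exists L, is_period c L.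
Proof.
  intros N H; destruct (Rlt_or_le 0 P) as [L|L].
  - exists P; split; auto.
  - exists (- P); split; [lra|]; intros s.
    rewrite <- (H (s + - P)); f_equal; ring.
Qed.

(** [phi] integrates the speed [v] and [psi] is its inverse, so the curve composed with [psi] has
    unit speed because psi' = 1 / v. *)
Lemma arc_length (c : R -> imq) (P : R) :
  smooth3 c -> (forall s, in_S2 (c s)) -> is_period c P ->
  (forall s, 0 < dot3 (deriv3 1 c s) (deriv3 1 c s)) ->
  exists phi psi dpsi : R -> R,
    closed_curve (fun r => c (psi r)) /\ change_of_parameter phi /\
    (forall s, psi (phi s) = s) /\
    (forall r, is_derive psi r (dpsi r)) /\ (forall r, 0 < dpsi r).
Proof.
  intros Sm S2 [P0 HP] Reg.
  set (v := fun s => sqrt (dot3 (deriv3 1 c s) (deriv3 1 c s))).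
  assert (v0 : forall s, 0 < v s) by (intros s; apply sqrt_lt_R0, Reg).
  assert (Sv : smooth1 v).
  { apply smooth1_sqrt; auto; apply smooth1_dot3; apply smooth3_deriv, Sm. }
  assert (vP : forall s, v (s + P) = v s)
    by (intros s; unfold v; rewrite periodic_deriv3; auto).
  destruct (periodic_speed_primitive v P Sv v0 P0 vP)
    as (phi & L & D & L0 & Q & Onto).
  (* A preimage is chosen for each [r]; strict monotonicity of [phi] makes it the inverse. *)
  pose (psi r := proj1_sig (constructive_indefinite_description _ (Onto r))).
  assert (phi_psi : forall r, phi (psi r) = r)
    by (intros r; exact (proj2_sig (constructive_indefinite_description _ (Onto r)))).
  assert (Dpsi : forall r, is_derive psi r (/ v (psi r)))
    by (intros r; apply (inverse_derive phi v); auto).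
  assert (Spsi : smooth1 psi) by (apply (inverse_smooth phi v); auto).
  assert (psi_phi : forall s, psi (phi s) = s)
    by (intros s; apply (positive_derive_inj phi v); auto).
  exists phi, psi, (fun r => / v (psi r)).
  split; [|split; [|split; [|split]]]; auto.
  - split; [|split; [|split]].
    + apply (smooth3_comp c psi Sm Spsi).
    + intros r; apply S2.
    + intros r; rewrite deriv3_comp; auto.
      rewrite (is_derive_unique _ _ _ (Dpsi r)), <- (pow2_sqrt (dot3 _ _)).
      * fold (v (psi r)); field; apply Rgt_not_eq, v0.
      * left; apply Reg.
    + exists L; split; auto; intros r.
      (* A shift of the parameter by [P] adds the length [L] of one period to [phi]. *)
      replace (psi (r + L)) with (psi r + P); auto.
      apply (positive_derive_inj phi v); auto. rewrite Q, !phi_psi; auto.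
  - split.
    + intros s; split; [eexists; apply D|].
      rewrite (is_derive_unique _ _ _ (D s)); auto.
    + intros r; exists (psi r); auto.
  - intros r; apply Rinv_0_lt_compat, v0.
Qed.

Lemma bounded_multiples (x : R) :
  (forall n, - PI < INR n * x < PI) -> x = 0.
Proof.
  intros H; destruct (Req_dec x 0) as [E|N]; auto; exfalso.
  pose proof (Rabs_pos_lt x N) as X0.
  destruct (INR_unbounded (PI / Rabs x)) as [n Hn].
  apply (Rmult_lt_compat_r (Rabs x)) in Hn; auto.
  unfold Rdiv in Hn; rewrite Rmult_assoc, Rinv_l, Rmult_1_r in Hn by lra.
  specialize (H n). unfold Rabs in *; destruct (Rcase_abs x); lra.
Qed.

Lemma total_curvature_zero (c : R -> imq) (L : R) :
  smooth3 c -> is_period c L ->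
  (forall b, 0 <= b -> - PI < RInt (geod_curv c) 0 b < PI) ->
  RInt (geod_curv c) 0 L = 0.
Proof.
  intros Sm [L0 HL] B; apply bounded_multiples; intros n.
  rewrite <- RInt_0_multiple.
  - apply B, Rmult_le_pos; [apply pos_INR|lra].
  - apply smooth1_geod_curv, Sm.
  - intros r; apply periodic_geod_curv, HL.
Qed.

(** * The two halves of a bivector *)

(** With [antiselfdual_part], the inverse of [of_pair]; the factors 1/2 in [of_pair] are why none
    appears here. *)
Definition selfdual_part (p : bivec) : imq :=
  Imq (b23 p + b01 p) (b31 p + b02 p) (b12 p + b03 p).
Definition antiselfdual_part (p : bivec) : imq :=
  Imq (b23 p - b01 p) (b31 p - b02 p) (b12 p - b03 p).

Lemma of_pair_halves (p : bivec) : of_pair (selfdual_part p) (antiselfdual_part p) = p.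
Proof. destruct p; unfold of_pair, bplus; simpl; f_equal; field. Qed.

(** For [u], [v] orthogonal to [F], both sides are the same vector normal to [F], [u] and [v]; in
    general they differ by the terms in <F, u> and <F, v> displayed in [E]. *)
Lemma wedge_halves_conj (F u v : vec4) (r : R) :
  dot4 F u = 0 -> dot4 F v = 0 ->
  im (selfdual_part (bscal r (wedge u v))) ** F
  = F ** im (antiselfdual_part (bscal r (wedge u v))).
Proof.
  intros Hu Hv.
  assert (E : im (selfdual_part (bscal r (wedge u v))) ** F =
    add4 (F ** im (antiselfdual_part (bscal r (wedge u v))))
         (add4 (scal4 (2 * r * dot4 F u) v) (scal4 (-2 * r * dot4 F v) u)))
    by (clear; unfold selfdual_part, antiselfdual_part, bscal, wedge; vec).
  rewrite E, Hu, Hv; generalize (F ** im (antiselfdual_part (bscal r (wedge u v)))).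
  clear; intros w; vec.
Qed.

Lemma wedge_plus_normal (F u v : vec4) (r x y : R) :
  dot4 F u = 0 -> dot4 F v = 0 ->
  dot4 (add4 (scal4 x u) (scal4 y v)) (im (selfdual_part (bscal r (wedge u v))) ** F) = 0.
Proof.
  intros Hu Hv.
  transitivity (r * x * (dot4 F u * dot4 u v - dot4 u u * dot4 F v)
                + r * y * (dot4 F u * dot4 v v - dot4 u v * dot4 F v)).
  - clear; unfold selfdual_part, bscal, wedge; coord; ring.
  - rewrite Hu, Hv; ring.
Qed.

Lemma wedge_plus_norm (u v : vec4) (r : R) :
  dot3 (selfdual_part (bscal r (wedge u v))) (selfdual_part (bscal r (wedge u v)))
  = r ^ 2 * (dot4 u u * dot4 v v - dot4 u v ^ 2).
Proof. unfold selfdual_part, bscal, wedge; coord; ring. Qed.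

Lemma wedge_minus_norm (u v : vec4) (r : R) :
  dot3 (antiselfdual_part (bscal r (wedge u v))) (antiselfdual_part (bscal r (wedge u v)))
  = r ^ 2 * (dot4 u u * dot4 v v - dot4 u v ^ 2).
Proof. unfold antiselfdual_part, bscal, wedge; coord; ring. Qed.

Lemma wedge_comb (u v : vec4) (x y z : R) :
  wedge (scal4 x u) (add4 (scal4 y u) (scal4 z v)) = bscal (x * z) (wedge u v).
Proof. unfold bscal, wedge; coord; f_equal; ring. Qed.

Lemma dot4_comb (u v : vec4) (x y z w : R) :
  dot4 (add4 (scal4 x u) (scal4 y v)) (add4 (scal4 z u) (scal4 w v)) =
  x * z * dot4 u u + (x * w + y * z) * dot4 u v + y * w * dot4 v v.
Proof. coord; ring. Qed.

Lemma gram_pos (u v : vec4) :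
  (forall x y, add4 (scal4 x u) (scal4 y v) = zero4 -> x = 0 /\ y = 0) ->
  0 < dot4 u u /\ 0 < dot4 u u * dot4 v v - dot4 u v ^ 2.
Proof.
  intros I.
  assert (P : forall x y, (x <> 0 \/ y <> 0) ->
    0 < x * x * dot4 u u + (x * y + y * x) * dot4 u v + y * y * dot4 v v).
  { intros x y N; rewrite <- dot4_comb.
    set (w := add4 (scal4 x u) (scal4 y v)).
    destruct (Req_dec (dot4 w w) 0) as [Z|Z].
    - apply dot4_eq0, I in Z; tauto.
    - assert (0 <= dot4 w w); [|lra].
      unfold dot4; pose proof (Rle_0_sqr (c0 w)); pose proof (Rle_0_sqr (c1 w));
      pose proof (Rle_0_sqr (c2 w)); pose proof (Rle_0_sqr (c3 w));
      unfold Rsqr in *; lra. }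
  assert (U : 0 < dot4 u u) by (specialize (P 1 0); lra).
  split; auto.
  (* This combination is orthogonal to [u], and its squared length is [dot4 u u] times the Gram
     determinant. *)
  specialize (P (- dot4 u v) (dot4 u u) (or_intror (Rgt_not_eq _ _ U))).
  nra.
Qed.

(** * The surface and its Gauss map *)

Section Surface.

Variable F : lorentz -> vec4.
Hypothesis hS3 : forall z, dot4 (F z) (F z) = 1.
Hypothesis himm : immersion F.

Definition Fx (z : lorentz) : vec4 :=
  Vec4 (dx (fun p => c0 (F p)) z) (dx (fun p => c1 (F p)) z)
       (dx (fun p => c2 (F p)) z) (dx (fun p => c3 (F p)) z).
Definition Fy (z : lorentz) : vec4 :=
  Vec4 (dy (fun p => c0 (F p)) z) (dy (fun p => c1 (F p)) z)
       (dy (fun p => c2 (F p)) z) (dy (fun p => c3 (F p)) z).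
Definition Fgram (z : lorentz) : R :=
  dot4 (Fx z) (Fx z) * dot4 (Fy z) (Fy z) - dot4 (Fx z) (Fy z) ^ 2.

Lemma diff4E (z u : lorentz) :
  diff4 F z u = add4 (scal4 (fst u) (Fx z)) (scal4 (snd u) (Fy z)).
Proof.
  destruct himm as [(H0 & H1 & H2 & H3) _].
  unfold diff4, add4; simpl; f_equal; rewrite smooth_diff; auto; ring.
Qed.

Lemma F_chain (u v : R -> R) (t du dv : R) :
  is_derive u t du -> is_derive v t dv ->
  is_derive4 (fun r => F (u r, v r)) t
    (add4 (scal4 du (Fx (u t, v t))) (scal4 dv (Fy (u t, v t)))).
Proof.
  intros Hu Hv; destruct himm as [(H0 & H1 & H2 & H3) _].
  split; [|split; [|split]]; simpl; eapply eq_derive.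
  - apply (smooth_chain (fun p => c0 (F p)) u v t du dv); auto.
  - unfold Fx, Fy; simpl; ring.
  - apply (smooth_chain (fun p => c1 (F p)) u v t du dv); auto.
  - unfold Fx, Fy; simpl; ring.
  - apply (smooth_chain (fun p => c2 (F p)) u v t du dv); auto.
  - unfold Fx, Fy; simpl; ring.
  - apply (smooth_chain (fun p => c3 (F p)) u v t du dv); auto.
  - unfold Fx, Fy; simpl; ring.
Qed.

Lemma F_comb_eq0 (z : lorentz) (x y : R) :
  add4 (scal4 x (Fx z)) (scal4 y (Fy z)) = zero4 -> x = 0 /\ y = 0.
Proof.
  intros E; pose proof (diff4E z (x, y)) as D; simpl in D; rewrite E in D.
  apply (proj2 himm) in D; injection D; auto.
Qed.

Lemma Fx_pos (z : lorentz) : 0 < dot4 (Fx z) (Fx z).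
Proof. apply (gram_pos (Fx z) (Fy z)), F_comb_eq0. Qed.

Lemma Fgram_pos (z : lorentz) : 0 < Fgram z.
Proof. apply (gram_pos (Fx z) (Fy z)), F_comb_eq0. Qed.

Lemma F_Fx (z : lorentz) : dot4 (F z) (Fx z) = 0.
Proof.
  destruct z as [x y].
  assert (D : is_derive4 (fun r => F (r, y)) x
                (add4 (scal4 1 (Fx (x, y))) (scal4 0 (Fy (x, y))))).
  { apply (F_chain (fun r => r) (fun _ => y)); auto_derive; auto. }
  pose proof (is_derive_const_eq _ _ 1 _ (fun r => hS3 (r, y))
                (is_derive_dot4 _ _ _ _ _ D D)) as K.
  unfold dot4, add4, scal4 in *; simpl in *; lra.
Qed.

Lemma F_Fy (z : lorentz) : dot4 (F z) (Fy z) = 0.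
Proof.
  destruct z as [x y].
  assert (D : is_derive4 (fun r => F (x, r)) y
                (add4 (scal4 0 (Fx (x, y))) (scal4 1 (Fy (x, y))))).
  { apply (F_chain (fun _ => x) (fun r => r)); auto_derive; auto. }
  pose proof (is_derive_const_eq _ _ 1 _ (fun r => hS3 (x, r))
                (is_derive_dot4 _ _ _ _ _ D D)) as K.
  unfold dot4, add4, scal4 in *; simpl in *; lra.
Qed.

Variables (eps : R) (G : lorentz -> bivec).
Hypothesis heps : eps = 1 \/ eps = -1.
Hypothesis hG : is_gauss_map F eps G.

(** [hG] speaks of oriented orthonormal bases, so it is applied to the Gram-Schmidt basis built from
    [Fx] and [Fy]. The explicit formula is what gives [G] its regularity and its periods. *)
Lemma gauss_formula (z : lorentz) :
  G z = bscal (eps * / sqrt (Fgram z)) (wedge (Fx z) (Fy z)).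
Proof.
  pose proof (Fx_pos z) as E0; pose proof (Fgram_pos z) as D0.
  set (E := dot4 (Fx z) (Fx z)) in *; set (D := Fgram z) in *.
  set (m := dot4 (Fx z) (Fy z)).
  assert (DE : D = E * dot4 (Fy z) (Fy z) - m ^ 2) by reflexivity.
  set (r := / sqrt E); set (k := / sqrt D).
  assert (r0 : 0 < r) by (apply Rinv_0_lt_compat, sqrt_lt_R0, E0).
  assert (k0 : 0 < k) by (apply Rinv_0_lt_compat, sqrt_lt_R0, D0).
  assert (r2 : r ^ 2 * E = 1).
  { unfold r; rewrite <- (pow2_sqrt E) at 2 by lra.
    field; apply Rgt_not_eq, sqrt_lt_R0, E0. }
  assert (k2 : k ^ 2 * D = 1).
  { unfold k; rewrite <- (pow2_sqrt D) at 2 by lra.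
    field; apply Rgt_not_eq, sqrt_lt_R0, D0. }
  assert (e2 : eps ^ 2 = 1) by (destruct heps as [-> | ->]; ring).
  (* Gram-Schmidt: the first vector is Fx / sqrt E, the second is the normalization of E Fy - m Fx,
     with [eps] fixing the orientation. *)
  set (a := (r, 0) : lorentz).
  set (b := (- (eps * r * k * m), eps * r * k * E) : lorentz).
  rewrite (hG z (diff4 F z a) (diff4 F z b)).
  - rewrite !diff4E; simpl.
    replace (add4 (scal4 r (Fx z)) (scal4 0 (Fy z))) with (scal4 r (Fx z))
      by (unfold add4, scal4; simpl; f_equal; ring).
    rewrite wedge_comb; f_equal.
    replace (r * (eps * r * k * E)) with (eps * k * (r ^ 2 * E)) by ring.
    rewrite r2; ring.
  - split; [|split; [|split]].
    + exists a, b; split; [|split]; auto.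
      unfold a, b, Ldet; simpl.
      replace (eps * (r * (eps * r * k * E) - 0 * - (eps * r * k * m)))
        with (eps ^ 2 * (r ^ 2 * E) * k) by ring.
      rewrite e2, r2; lra.
    + rewrite !diff4E, dot4_comb; simpl; fold E m. rewrite <- r2; ring.
    + rewrite !diff4E, dot4_comb; simpl; fold E m.
      replace (dot4 (Fy z) (Fy z)) with ((D + m ^ 2) / E)
        by (rewrite DE; field; lra).
      transitivity (eps ^ 2 * (r ^ 2 * E) * (k ^ 2 * D)); [field; lra|].
      rewrite e2, r2, k2; ring.
    + rewrite !diff4E, dot4_comb; simpl; fold E m; ring.
Qed.

Definition Gp (z : lorentz) : imq := selfdual_part (G z).
Definition Gm (z : lorentz) : imq := antiselfdual_part (G z).

Lemma gauss_conj (z : lorentz) : im (Gp z) ** F z = F z ** im (Gm z).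
Proof.
  unfold Gp, Gm; rewrite gauss_formula.
  apply wedge_halves_conj; [apply F_Fx|apply F_Fy].
Qed.

Lemma gauss_normal (z : lorentz) (x y : R) :
  dot4 (add4 (scal4 x (Fx z)) (scal4 y (Fy z))) (im (Gp z) ** F z) = 0.
Proof.
  unfold Gp; rewrite gauss_formula.
  apply wedge_plus_normal; [apply F_Fx|apply F_Fy].
Qed.

Lemma gauss_factor (z : lorentz) : (eps * / sqrt (Fgram z)) ^ 2 * Fgram z = 1.
Proof.
  pose proof (Fgram_pos z) as D0.
  transitivity (eps ^ 2).
  - rewrite <- (pow2_sqrt (Fgram z)) at 2 by lra.
    field; apply Rgt_not_eq, sqrt_lt_R0, D0.
  - destruct heps as [-> | ->]; ring.
Qed.

Lemma Gp_S2 (z : lorentz) : in_S2 (Gp z).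
Proof.
  unfold in_S2, Gp; rewrite gauss_formula, wedge_plus_norm; apply gauss_factor.
Qed.

Lemma Gm_S2 (z : lorentz) : in_S2 (Gm z).
Proof.
  unfold in_S2, Gm; rewrite gauss_formula, wedge_minus_norm; apply gauss_factor.
Qed.

(** [is_gauss_map] prescribes values only; smoothness is read off [gauss_formula], whose square root
    has a positive argument. *)
Lemma gauss_line_smooth (z u : lorentz) :
  smooth1 (fun h => b01 (G (line z u h))) /\ smooth1 (fun h => b02 (G (line z u h))) /\
  smooth1 (fun h => b03 (G (line z u h))) /\ smooth1 (fun h => b23 (G (line z u h))) /\
  smooth1 (fun h => b31 (G (line z u h))) /\ smooth1 (fun h => b12 (G (line z u h))).
Proof.
  destruct himm as [(H0 & H1 & H2 & H3) _].
  assert (X0 : smooth1 (fun h => c0 (Fx (line z u h))))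
    by (apply (smooth_line (dx (fun p => c0 (F p)))), smooth_dx, H0).
  assert (X1 : smooth1 (fun h => c1 (Fx (line z u h))))
    by (apply (smooth_line (dx (fun p => c1 (F p)))), smooth_dx, H1).
  assert (X2 : smooth1 (fun h => c2 (Fx (line z u h))))
    by (apply (smooth_line (dx (fun p => c2 (F p)))), smooth_dx, H2).
  assert (X3 : smooth1 (fun h => c3 (Fx (line z u h))))
    by (apply (smooth_line (dx (fun p => c3 (F p)))), smooth_dx, H3).
  assert (Y0 : smooth1 (fun h => c0 (Fy (line z u h))))
    by (apply (smooth_line (dy (fun p => c0 (F p)))), smooth_dy, H0).
  assert (Y1 : smooth1 (fun h => c1 (Fy (line z u h))))
    by (apply (smooth_line (dy (fun p => c1 (F p)))), smooth_dy, H1).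
  assert (Y2 : smooth1 (fun h => c2 (Fy (line z u h))))
    by (apply (smooth_line (dy (fun p => c2 (F p)))), smooth_dy, H2).
  assert (Y3 : smooth1 (fun h => c3 (Fy (line z u h))))
    by (apply (smooth_line (dy (fun p => c3 (F p)))), smooth_dy, H3).
  assert (K : smooth1 (fun h => eps * / sqrt (Fgram (line z u h)))).
  { apply smooth1_mult; [apply smooth1_const|].
    apply (smooth1_inv (fun h => sqrt (Fgram (line z u h)))).
    - intros h; apply Rgt_not_eq, sqrt_lt_R0, Fgram_pos.
    - apply (smooth1_sqrt (fun h => Fgram (line z u h)));
        [intros; apply Fgram_pos|].
      unfold Fgram, dot4, pow; repeat
        lazymatch goal with
        | |- smooth1 (fun h => _ + _) => apply smooth1_plus
        | |- smooth1 (fun h => _ - _) => apply smooth1_minus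
        | |- smooth1 (fun h => _ * _) => apply smooth1_mult
        | |- smooth1 (fun h => 1) => apply smooth1_const
        | _ => assumption
        end. }
  assert (C : forall f1 f2 f3 f4 : R -> R,
    smooth1 f1 -> smooth1 f2 -> smooth1 f3 -> smooth1 f4 ->
    smooth1 (fun h => eps * / sqrt (Fgram (line z u h)) *
                      (f1 h * f2 h - f3 h * f4 h)))
    by (intros; apply smooth1_mult; auto with smooth).
  split; [|split; [|split; [|split; [|split]]]].
  - apply (smooth1_ext _ _ (fun h => eq_sym (f_equal b01 (gauss_formula _)))), C; auto.
  - apply (smooth1_ext _ _ (fun h => eq_sym (f_equal b02 (gauss_formula _)))), C; auto.
  - apply (smooth1_ext _ _ (fun h => eq_sym (f_equal b03 (gauss_formula _)))), C; auto.
  - apply (smooth1_ext _ _ (fun h => eq_sym (f_equal b23 (gauss_formula _)))), C; auto.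
  - apply (smooth1_ext _ _ (fun h => eq_sym (f_equal b31 (gauss_formula _)))), C; auto.
  - apply (smooth1_ext _ _ (fun h => eq_sym (f_equal b12 (gauss_formula _)))), C; auto.
Qed.

Lemma gauss_line_smooth3 (z u : lorentz) :
  smooth3 (fun h => Gp (line z u h)) /\ smooth3 (fun h => Gm (line z u h)).
Proof.
  destruct (gauss_line_smooth z u) as (? & ? & ? & ? & ? & ?).
  split; split; [|split| |split]; simpl; auto with smooth.
Qed.

(** * The null directions and the curves [alpha] and [beta] *)

Hypothesis hLor : forall z u,
  diffb G z (Lmult Lsigma u) = lact Lsigma (diffb G z u).

(** For u = (1, -1), sigma u = -u, so [hLor] makes dG(u) anti-self-dual and the self-dual sums have
    zero derivative along [u]. *)
Lemma Gp_const (z : lorentz) (h : R) : Gp (line z (1, -1) h) = Gp z.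
Proof.
  set (u := (1, -1) : lorentz).
  assert (H : forall z, diffb G z (Lmult Lsigma u) = lact Lsigma (diffb G z u))
    by (intros; apply hLor).
  assert (V : Lmult Lsigma u = Lscal (-1) u)
    by (unfold u, Lmult, Lscal, Lsigma; simpl; f_equal; ring).
  rewrite V in H; clearbody u.
  assert (M : forall x y, x + y = x + 1 * y) by (intros; ring).
  unfold Gp, selfdual_part; f_equal; rewrite (M (_ (G (line z u h)))), (M (_ (G z))).
  - apply (sum_line_const (fun z => b23 (G z)) (fun z => b01 (G z))); intros w.
    + destruct (gauss_line_smooth w u) as (_ & _ & _ & K & _); exact K.
    + destruct (gauss_line_smooth w u) as (K & _); exact K.
    + destruct (gauss_line_smooth w u) as (K & _);
      specialize (H w); apply (f_equal b01) in H; simpl in H.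
      rewrite (diff_opp (fun z => b01 (G z)) w u _ K eq_refl) in H; simpl in H |- *; lra.
  - apply (sum_line_const (fun z => b31 (G z)) (fun z => b02 (G z))); intros w.
    + destruct (gauss_line_smooth w u) as (_ & _ & _ & _ & K & _); exact K.
    + destruct (gauss_line_smooth w u) as (_ & K & _); exact K.
    + destruct (gauss_line_smooth w u) as (_ & K & _);
      specialize (H w); apply (f_equal b02) in H; simpl in H.
      rewrite (diff_opp (fun z => b02 (G z)) w u _ K eq_refl) in H; simpl in H |- *; lra.
  - apply (sum_line_const (fun z => b12 (G z)) (fun z => b03 (G z))); intros w.
    + destruct (gauss_line_smooth w u) as (_ & _ & _ & _ & _ & K); exact K.
    + destruct (gauss_line_smooth w u) as (_ & _ & K & _); exact K.
    + destruct (gauss_line_smooth w u) as (_ & _ & K & _);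
      specialize (H w); apply (f_equal b03) in H; simpl in H.
      rewrite (diff_opp (fun z => b03 (G z)) w u _ K eq_refl) in H; simpl in H |- *; lra.
Qed.

(** For u = (1, 1), sigma u = u, so dG(u) is self-dual and the anti-self-dual differences have zero
    derivative along [u]. *)
Lemma Gm_const (z : lorentz) (h : R) : Gm (line z (1, 1) h) = Gm z.
Proof.
  set (u := (1, 1) : lorentz).
  assert (H : forall z, diffb G z (Lmult Lsigma u) = lact Lsigma (diffb G z u))
    by (intros; apply hLor).
  assert (V : Lmult Lsigma u = u)
    by (unfold u, Lmult, Lsigma; simpl; f_equal; ring).
  rewrite V in H; clearbody u.
  assert (M : forall x y, x - y = x + -1 * y) by (intros; ring).
  unfold Gm, antiselfdual_part; rewrite !M; f_equal.
  - apply (sum_line_const (fun z => b23 (G z)) (fun z => b01 (G z))); intros w.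
    + destruct (gauss_line_smooth w u) as (_ & _ & _ & K & _); exact K.
    + destruct (gauss_line_smooth w u) as (K & _); exact K.
    + specialize (H w); apply (f_equal b01) in H; simpl in H |- *; lra.
  - apply (sum_line_const (fun z => b31 (G z)) (fun z => b02 (G z))); intros w.
    + destruct (gauss_line_smooth w u) as (_ & _ & _ & _ & K & _); exact K.
    + destruct (gauss_line_smooth w u) as (_ & K & _); exact K.
    + specialize (H w); apply (f_equal b02) in H; simpl in H |- *; lra.
  - apply (sum_line_const (fun z => b12 (G z)) (fun z => b03 (G z))); intros w.
    + destruct (gauss_line_smooth w u) as (_ & _ & _ & _ & _ & K); exact K.
    + destruct (gauss_line_smooth w u) as (_ & _ & K & _); exact K.
    + specialize (H w); apply (f_equal b03) in H; simpl in H |- *; lra.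
Qed.

(** Each half of [G] depends on one null coordinate, so its restriction to the real axis determines
    it. *)
Definition alpha (s : R) : imq := Gp (s, 0).
Definition beta (t : R) : imq := Gm (t, 0).

Lemma Gp_alpha (x y : R) : Gp (x, y) = alpha (x + y).
Proof.
  rewrite <- (Gp_const (x, y) y); unfold alpha; f_equal.
  unfold line, Lplus, Lscal; simpl; f_equal; ring.
Qed.

Lemma Gm_beta (x y : R) : Gm (x, y) = beta (x - y).
Proof.
  rewrite <- (Gm_const (x, y) (- y)); unfold beta; f_equal.
  unfold line, Lplus, Lscal; simpl; f_equal; ring.
Qed.

Lemma alpha_smooth : smooth3 alpha.
Proof.
  apply (smooth3_ext (fun s => Gp (line (0, 0) (1, 0) s))).
  - intros s; rewrite line_x; reflexivity.
  - exact (proj1 (gauss_line_smooth3 (0, 0) (1, 0))).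
Qed.

Lemma beta_smooth : smooth3 beta.
Proof.
  apply (smooth3_ext (fun s => Gm (line (0, 0) (1, 0) s))).
  - intros s; rewrite line_x; reflexivity.
  - exact (proj2 (gauss_line_smooth3 (0, 0) (1, 0))).
Qed.

(* [F] in the null coordinates [s = x + y], [t = x - y], each of them
   reparametrized. *)
Definition Fnull (psi1 psi2 : R -> R) (s t : R) : vec4 :=
  F ((psi1 s + psi2 t) / 2, (psi1 s - psi2 t) / 2).

Lemma Fnull_conj (psi1 psi2 : R -> R) (s t : R) :
  im (alpha (psi1 s)) ** Fnull psi1 psi2 s t
  = Fnull psi1 psi2 s t ** im (beta (psi2 t)).
Proof.
  unfold Fnull.
  set (x := (psi1 s + psi2 t) / 2); set (y := (psi1 s - psi2 t) / 2).
  replace (psi1 s) with (x + y) by (unfold x, y; field).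
  replace (psi2 t) with (x - y) by (unfold x, y; field).
  rewrite <- Gp_alpha, <- Gm_beta; apply gauss_conj.
Qed.

Lemma Fnull_normal (psi1 psi2 : R -> R) (s t x y : R) :
  let z := ((psi1 s + psi2 t) / 2, (psi1 s - psi2 t) / 2) in
  dot4 (add4 (scal4 x (Fx z)) (scal4 y (Fy z)))
       (im (alpha (psi1 s)) ** Fnull psi1 psi2 s t) = 0.
Proof.
  intros z; replace (psi1 s) with (fst z + snd z) at 1 by (unfold z; simpl; field).
  rewrite <- Gp_alpha; apply gauss_normal.
Qed.

Lemma Fnull_derive_s (psi1 psi2 : R -> R) (s t d : R) :
  is_derive psi1 s d ->
  let z := ((psi1 s + psi2 t) / 2, (psi1 s - psi2 t) / 2) in
  is_derive4 (fun r => Fnull psi1 psi2 r t) s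
    (add4 (scal4 (d / 2) (Fx z)) (scal4 (d / 2) (Fy z))).
Proof.
  intros D z.
  apply (F_chain (fun r => (psi1 r + psi2 t) / 2) (fun r => (psi1 r - psi2 t) / 2));
    (auto_derive; [eexists; exact D|]);
    replace (Derive _ _) with d by (symmetry; apply is_derive_unique, D); field.
Qed.

Lemma Fnull_derive_t (psi1 psi2 : R -> R) (s t d : R) :
  is_derive psi2 t d ->
  let z := ((psi1 s + psi2 t) / 2, (psi1 s - psi2 t) / 2) in
  is_derive4 (fun r => Fnull psi1 psi2 s r) t
    (add4 (scal4 (d / 2) (Fx z)) (scal4 (- d / 2) (Fy z))).
Proof.
  intros D z.
  apply (F_chain (fun r => (psi1 s + psi2 r) / 2) (fun r => (psi1 s - psi2 r) / 2));
    (auto_derive; [eexists; exact D|]);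
    replace (Derive _ _) with d by (symmetry; apply is_derive_unique, D); field.
Qed.

Lemma F_comb_ortho (z : lorentz) (x y : R) :
  dot4 (F z) (add4 (scal4 x (Fx z)) (scal4 y (Fy z))) = 0.
Proof.
  transitivity (x * dot4 (F z) (Fx z) + y * dot4 (F z) (Fy z)).
  - unfold dot4, add4, scal4; simpl; ring.
  - rewrite F_Fx, F_Fy; ring.
Qed.

(** If alpha' vanished, F_s = (1/2) alpha alpha' F would vanish too, against the immersion. The null
    coordinates are taken without reparametrization, hence [id]. *)
Lemma alpha_regular (s : R) : 0 < dot3 (deriv3 1 alpha s) (deriv3 1 alpha s).
Proof.
  apply dot3_pos; intros E.
  set (id := fun r : R => r).
  assert (I : is_derive id s 1) by (unfold id; auto_derive; auto).
  pose proof (Fnull_derive_s id id s 0 1 I) as D; cbv zeta in D.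
  set (z := ((id s + id 0) / 2, (id s - id 0) / 2)) in D.
  pose proof (is_derive4_qmul _ _ _ _ _
    (is_derive4_im _ _ _ (smooth3_is_derive alpha s alpha_smooth)) D) as D1.
  pose proof (is_derive4_qmul _ _ _ _ _
    D (is_derive4_const (im (beta 0)) s)) as D2.
  rewrite add4_0r in D2.
  pose proof (is_derive4_unique _ _ _ _ _ (fun r => Fnull_conj id id r 0) D1 D2) as K.
  apply frame_partial_s in K.
  - rewrite E in K.
    assert (Z : forall u v, scal4 (/ 2) (im u ** (im (Imq 0 0 0) ** v)) = zero4)
      by (clear; intros u v; unfold zero4; vec).
    rewrite Z in K. apply F_comb_eq0 in K; lra.
  - apply hS3.
  - apply (Fnull_conj id id s 0).
  - apply F_comb_ortho.
  - apply (Fnull_normal id id s 0).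
  - apply Gp_S2.
Qed.

(** The same argument with F_t = (1/2) F beta' beta. *)
Lemma beta_regular (t : R) : 0 < dot3 (deriv3 1 beta t) (deriv3 1 beta t).
Proof.
  apply dot3_pos; intros E.
  set (id := fun r : R => r).
  assert (I : is_derive id t 1) by (unfold id; auto_derive; auto).
  pose proof (Fnull_derive_t id id 0 t 1 I) as D; cbv zeta in D.
  set (z := ((id 0 + id t) / 2, (id 0 - id t) / 2)) in D.
  pose proof (is_derive4_qmul _ _ _ _ _ D
    (is_derive4_im _ _ _ (smooth3_is_derive beta t beta_smooth))) as D1.
  pose proof (is_derive4_qmul _ _ _ _ _
    (is_derive4_const (im (alpha 0)) t) D) as D2.
  rewrite add4_0l in D2.
  pose proof (is_derive4_unique _ _ _ _ _ (fun r => Fnull_conj id id 0 r) D2 D1) as K.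
  apply frame_partial_t in K.
  - rewrite E in K.
    assert (Z : forall u v, scal4 (/ 2) (v ** im (Imq 0 0 0) ** im u) = zero4)
      by (clear; intros u v; unfold zero4; vec).
    rewrite Z in K. apply F_comb_eq0 in K; lra.
  - apply hS3.
  - apply (Fnull_conj id id 0 t).
  - apply Gm_S2.
  - apply F_comb_ortho.
  - apply (Fnull_normal id id 0 t).
Qed.

(** * Periods coming from the lattice *)

Variable Gam : lorentz -> Prop.
Hypothesis hper : forall z g, Gam g -> F (Lplus z g) = F z.

(** The partial derivatives of [F] inherit its periods, and by [gauss_formula] they determine
    [G]. *)
Lemma gauss_periodic (g z : lorentz) : Gam g -> G (Lplus z g) = G z.
Proof.
  intros Hg.
  assert (EX : Fx (Lplus z g) = Fx z)
    by (unfold Fx; f_equal; apply dx_periodic; intros; rewrite hper; auto).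
  assert (EY : Fy (Lplus z g) = Fy z)
    by (unfold Fy; f_equal; apply dy_periodic; intros; rewrite hper; auto).
  rewrite !gauss_formula; unfold Fgram; rewrite EX, EY; reflexivity.
Qed.

Lemma alpha_period (g : lorentz) (s : R) :
  Gam g -> alpha (s + (fst g + snd g)) = alpha s.
Proof.
  intros Hg; unfold alpha at 2, Gp; rewrite <- (gauss_periodic g _ Hg).
  change (alpha (s + (fst g + snd g)) = Gp (s + fst g, 0 + snd g)).
  rewrite Gp_alpha; f_equal; ring.
Qed.

Lemma beta_period (g : lorentz) (t : R) :
  Gam g -> beta (t + (fst g - snd g)) = beta t.
Proof.
  intros Hg; unfold beta at 2, Gm; rewrite <- (gauss_periodic g _ Hg).
  change (beta (t + (fst g - snd g)) = Gm (t + fst g, 0 + snd g)).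
  rewrite Gm_beta; f_equal; ring.
Qed.

Hypothesis hGam : rank_two_lattice Gam.

(** Two generators on the line x + y = 0, or both on x - y = 0, would have determinant 0; so some
    generator projects to a nonzero period in each null coordinate. *)
Lemma periods :
  (exists L, is_period alpha L) /\ (exists L, is_period beta L).
Proof.
  destruct hGam as (g1 & g2 & N & H).
  assert (H1 : Gam g1).
  { apply H; exists 1%Z, 0%Z; destruct g1, g2; unfold Lplus, Lscal; simpl; f_equal; ring. }
  assert (H2 : Gam g2).
  { apply H; exists 0%Z, 1%Z; destruct g1, g2; unfold Lplus, Lscal; simpl; f_equal; ring. }
  unfold Ldet in N; split.
  - destruct (Req_dec (fst g1 + snd g1) 0) as [Z1|Z1];
      [destruct (Req_dec (fst g2 + snd g2) 0) as [Z2|Z2]|].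
    + exfalso; apply N.
      replace (snd g1) with (- fst g1) by lra; replace (snd g2) with (- fst g2) by lra.
      ring.
    + apply (positive_period _ _ Z2); intros; apply alpha_period; auto.
    + apply (positive_period _ _ Z1); intros; apply alpha_period; auto.
  - destruct (Req_dec (fst g1 - snd g1) 0) as [Z1|Z1];
      [destruct (Req_dec (fst g2 - snd g2) 0) as [Z2|Z2]|].
    + exfalso; apply N.
      replace (snd g1) with (fst g1) by lra; replace (snd g2) with (fst g2) by lra.
      ring.
    + apply (positive_period _ _ Z2); intros; apply beta_period; auto.
    + apply (positive_period _ _ Z1); intros; apply beta_period; auto.
Qed.

End Surface.

(** * Passage to arc length and assembly of the conclusions *)

Theorem corollary2 (Gam : lorentz -> Prop) (F : lorentz -> vec4) (eps : R)
    (G : lorentz -> bivec)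
    (hGam : rank_two_lattice Gam)
    (hper : forall z g : lorentz, Gam g -> F (Lplus z g) = F z)
    (hS3 : forall z : lorentz, dot4 (F z) (F z) = 1)
    (himm : immersion F)
    (hflat : flat F)
    (heps : eps = 1 \/ eps = -1)
    (hG : is_gauss_map F eps G)
    (hLor : forall z u : lorentz,
      diffb G z (Lmult Lsigma u) = lact Lsigma (diffb G z u)) :
  exists gam1 gam2 : R -> imq,
    closed_curve gam1 /\ closed_curve gam2 /\
    (forall eta : bivec,
      (exists z : lorentz, G z = eta) <->
      (exists s t : R, eta = of_pair (gam1 s) (gam2 t))) /\
    (exists phi1 phi2 : R -> R,
      change_of_parameter phi1 /\ change_of_parameter phi2 /\
      forall x y : R,
        G (x, y) = of_pair (gam1 (phi1 (x + y))) (gam2 (phi2 (x - y)))) /\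
    (forall a b c d : R, a <= b -> c <= d ->
      - PI < RInt (geod_curv gam1) a b - RInt (geod_curv gam2) c d < PI) /\
    (forall L : R, is_period gam1 L -> RInt (geod_curv gam1) 0 L = 0) /\
    (forall L : R, is_period gam2 L -> RInt (geod_curv gam2) 0 L = 0).
Proof.
  pose proof (alpha_smooth F himm eps G heps hG) as Sa.
  pose proof (beta_smooth F himm eps G heps hG) as Sb.
  destruct (periods F himm eps G heps hG hLor Gam hper hGam) as [[P1 HP1] [P2 HP2]].
  destruct (arc_length (alpha G) P1 Sa
    (fun s => Gp_S2 F himm eps G heps hG (s, 0)) HP1
    (alpha_regular F hS3 himm eps G heps hG hLor))
    as (phi1 & psi1 & d1 & C1 & CP1 & I1 & D1 & d1_pos).
  destruct (arc_length (beta G) P2 Sb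
    (fun s => Gm_S2 F himm eps G heps hG (s, 0)) HP2
    (beta_regular F hS3 himm eps G heps hG hLor))
    as (phi2 & psi2 & d2 & C2 & CP2 & I2 & D2 & d2_pos).
  set (g1 := fun r => alpha G (psi1 r)) in *.
  set (g2 := fun r => beta G (psi2 r)) in *.
  assert (GE : forall x y, G (x, y) = of_pair (alpha G (x + y)) (beta G (x - y))).
  { intros x y.
    rewrite <- (Gp_alpha F himm eps G heps hG hLor),
            <- (Gm_beta F himm eps G heps hG hLor).
    symmetry; apply of_pair_halves. }
  destruct C1 as (S1 & Q1 & U1 & L1), C2 as (S2 & Q2 & U2 & L2).
  set (zz s t := ((psi1 s + psi2 t) / 2, (psi1 s - psi2 t) / 2)).
  assert (B : forall a b c d,
    - PI < RInt (geod_curv g1) a b - RInt (geod_curv g2) c d < PI).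
  { apply (angle_bound (Fnull F psi1 psi2)
      (fun s t => add4 (scal4 (d1 s / 2) (Fx F (zz s t)))
                       (scal4 (d1 s / 2) (Fy F (zz s t))))
      (fun s t => add4 (scal4 (d2 t / 2) (Fx F (zz s t)))
                       (scal4 (- d2 t / 2) (Fy F (zz s t))))); auto.
    - intros s t; apply Fnull_derive_s; auto.
    - intros s t; apply Fnull_derive_t; auto.
    - intros s t; apply hS3.
    - intros s t; apply (Fnull_conj F hS3 himm eps G heps hG hLor).
    - intros s t; apply (Fnull_normal F hS3 himm eps G heps hG hLor).
    - intros s t; apply (Fnull_normal F hS3 himm eps G heps hG hLor).
    - intros s t r E.
      (* F_s = r F_t written in the basis [Fx], [Fy]; the two coefficients must vanish, and their
         sum [d1 s] is positive. *)
      assert (K : add4 (scal4 (d1 s / 2 - r * (d2 t / 2)) (Fx F (zz s t)))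
                       (scal4 (d1 s / 2 + r * (d2 t / 2)) (Fy F (zz s t))) = zero4).
      { revert E; generalize (Fx F (zz s t)) (Fy F (zz s t)) (d1 s) (d2 t).
        clear; intros u v x y E; coord; unfold zero4.
        injection E as ? ? ? ?; f_equal; lra. }
      apply (F_comb_eq0 F himm) in K; specialize (d1_pos s); lra. }
  assert (RInt0 : forall c b, RInt (geod_curv c) b b = 0)
    by (intros; apply (RInt_point (V := R_CompleteNormedModule))).
  exists g1, g2; split; [|split; [|split; [|split; [|split; [|split]]]]]; auto.
  - repeat split; auto; apply S1.
  - repeat split; auto; apply S2.
  - intros eta; split.
    + intros [[x y] <-]; exists (phi1 (x + y)), (phi2 (x - y)).
      unfold g1, g2; rewrite I1, I2; apply GE.
    + intros (s & t & ->); exists (zz s t); unfold zz; rewrite GE.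
      f_equal; unfold g1, g2; f_equal; field.
  - exists phi1, phi2; split; [|split]; auto; intros x y.
    unfold g1, g2; rewrite I1, I2; apply GE.
  (* The bound with the other interval reduced to a point bounds the curvature integrals of this
     curve alone. *)
  - intros L HL; apply total_curvature_zero; auto; intros b _.
    specialize (B 0 b 0 0); rewrite (RInt0 g2) in B; lra.
  - intros L HL; apply total_curvature_zero; auto; intros b _.
    specialize (B 0 0 0 b); rewrite (RInt0 g1) in B; lra.
Qed.
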